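(* Let $R=(V,A)$ be a strongly connected digraph (request graph). The following three statements are equivalent: (1) $R$ is walk-Helly; (2) there exists a tree representation of $R$; (3) there exists a tree solution for MinCRS on $R$. Moreover, if such a tree solution exists, one can be computed in polynomial time.
   Context: A temporal graph is a pair $\mathcal G=(V,\mathcal E)$ where $\mathcal E$ is a finite set of (distinct) temporal edges $(\{u,v\},t)$ with $u\neq v\in V$ and $t$ a positive integer. A journey from $u_0$ to $u_k$ is a sequence $(u_0,u_1,t_0),\dots,(u_{k-1},u_k,t_{k-1})$ with each $(\{u_i,u_{i+1}\},t_i)\in\mathcal E$ and $t_0<\dots<t_{k-1}$. The footprint $\mathcal G_\downarrow$ is the undirected graph on $V$ with edge set $\{\{u,v\}:(\{u,v\},t)\in\mathcal E\text{ for some }t\}$. MinCRS asks, given a digraph $R=(V,A)$, for a temporal graph on $V$ with the minimum number of temporal edges such that for every arc $(u,v)\in A$ there is a journey from $u$ to $v$ (such a temporal graph is a solution). For connected $R$, a tree solution is a solution with exactly $n-1$ temporal edges ($n=|V|$), so that its footprint is a tree. A closed walk of a digraph is a sequence $(u_0,\dots,u_k)$, $k\ge1$, with $(u_i,u_{i+1})$ an arc for all $i$ and $u_k=u_0$. A tree representation of $R$ is a tree $T$ on vertex set $V$ such that $T[S]$ is connected for the vertex set $S$ of every closed walk of $R$. A family of sets has the Helly property if every subfamily of pairwise intersecting sets has a common element. $R$ is walk-Helly if the family of vertex sets of closed walks of $R$ has the Helly property, i.e. any set of pairwise non-vertex-disjoint closed walks all share a common vertex. *)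

(* Defs.v *)
From HB Require Import structures.
From mathcomp Require Import all_boot finmap.

Set Implicit Arguments.
Unset Strict Implicit.
Unset Printing Implicit Defensive.

(* A digraph on V is its arc relation A : rel V. Loops are not excluded; they
   are harmless since the empty journey serves the request (u, u). *)

Section Digraphs.
Variables (V : finType) (A : rel V).

Definition strongly_connected : Prop :=
  0 < #|V| /\ forall u v : V, connect A u v.

(* The walk (u_0, ..., u_k) is passed as its head u = u_0 and its tail
   p = (u_1, ..., u_k), so that k >= 1 means p != [::]. *)
Definition closed_walk (u : V) (p : seq V) : bool :=
  [&& p != [::], path A u p & last u p == u].

Definition closed_walk_set (S : {set V}) : Prop :=
  exists u p, closed_walk u p /\ S = [set x in u :: p].

End Digraphs.

Definition helly (V : finType) (F : {set V} -> Prop) : Prop :=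
  forall H : {set {set V}},
    (forall S, S \in H -> F S) ->
    (forall S S', S \in H -> S' \in H -> S :&: S' != set0) ->
    exists x : V, forall S, S \in H -> x \in S.

Definition walk_helly (V : finType) (A : rel V) : Prop :=
  helly (closed_walk_set A).

Section Trees.
Variables (V : finType) (T : rel V).

(* connectedness of the induced subgraph T[S] *)
Definition connected_on (S : {set V}) : Prop :=
  forall x y, x \in S -> y \in S ->
    connect [rel a b | [&& a \in S, b \in S & T a b]] x y.

Definition is_tree : Prop :=
  [/\ symmetric T,
      irreflexive T,
      connected_on [set: V]
    & forall c : seq V, 2 < size c -> ~ ucycle T c].

End Trees.

Definition tree_representation (V : finType) (A T : rel V) : Prop :=
  is_tree T /\ forall S, closed_walk_set A S -> connected_on T S.

Record temporal_graph (V : finType) := TemporalGraph {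
  tedges : {fset {set V} * nat};
  tedges_ok : forall e, e \in tedges -> #|e.1| = 2 /\ 0 < e.2
}.

Section TemporalGraphs.
Variables (V : finType).
Implicit Types (G : temporal_graph V) (A : rel V).

(* The last conjunct says that the steps are chained and lead from u to v:
   u followed by the heads is the same sequence as the tails followed by v. *)
Definition journey G (u v : V) (j : seq (V * V * nat)) : bool :=
  [&& all (fun s => ([set s.1.1; s.1.2], s.2) \in tedges G) j,
      sorted ltn [seq s.2 | s <- j]
    & u :: [seq s.1.2 | s <- j] == rcons [seq s.1.1 | s <- j] v].

Definition solution A G : Prop :=
  forall u v : V, A u v -> exists j, journey G u v j.

Definition tree_solution A G : Prop :=
  solution A G /\ #|` tedges G| = #|V|.-1.

End TemporalGraphs.

(* Model of computation: while-programs over integer arrays, i.e. a structured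
   random access machine. The memory consists of arrays named by naturals,
   each with two indices; a scalar variable is a cell x[0, 0]. The arithmetic
   is restricted to + and truncated -, so that unit cost per operation is
   polynomially related to Turing machine time. A test succeeds on nonzero
   values. *)

Definition store := nat -> nat -> nat -> nat.

Inductive expr :=
  | Const of nat
  | Cell of nat & expr & expr
  | Add of expr & expr
  | Sub of expr & expr.

Inductive cmd :=
  | Skip
  | Assign of nat & expr & expr & expr (* Assign x i j e is x[i, j] := e *)
  | Seq of cmd & cmd
  | If of expr & cmd & cmd
  | While of expr & cmd.

Fixpoint eval (s : store) (e : expr) : nat :=
  match e with
  | Const m => m
  | Cell x i j => s x (eval s i) (eval s j)
  | Add e1 e2 => eval s e1 + eval s e2
  | Sub e1 e2 => eval s e1 - eval s e2
  end.

Fixpoint cost (e : expr) : nat :=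
  match e with
  | Const _ => 1
  | Cell _ e1 e2 | Add e1 e2 | Sub e1 e2 => (cost e1 + cost e2).+1
  end.

Definition update (s : store) (x i j m : nat) : store :=
  fun x' i' j' => if [&& x' == x, i' == i & j' == j] then m else s x' i' j'.

(* exec c s t s': run from s, the program c halts in s' after t steps. *)
Inductive exec : cmd -> store -> nat -> store -> Prop :=
  | ExecSkip s : exec Skip s 1 s
  | ExecAssign s x i j e :
      exec (Assign x i j e) s (cost i + cost j + cost e).+1
        (update s x (eval s i) (eval s j) (eval s e))
  | ExecSeq c1 c2 s1 s2 s3 t1 t2 :
      exec c1 s1 t1 s2 -> exec c2 s2 t2 s3 ->
      exec (Seq c1 c2) s1 (t1 + t2) s3
  | ExecIfTrue e c1 c2 s s' t :
      eval s e != 0 -> exec c1 s t s' ->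
      exec (If e c1 c2) s (cost e + t).+1 s'
  | ExecIfFalse e c1 c2 s s' t :
      eval s e = 0 -> exec c2 s t s' ->
      exec (If e c1 c2) s (cost e + t).+1 s'
  | ExecWhileTrue e c s1 s2 s3 t1 t2 :
      eval s1 e != 0 -> exec c s1 t1 s2 -> exec (While e c) s2 t2 s3 ->
      exec (While e c) s1 (cost e + t1 + t2).+1 s3
  | ExecWhileFalse e c s :
      eval s e = 0 -> exec (While e c) s (cost e).+1 s.

(* Input format: cell 0[0, 0] holds n, array 1 the adjacency matrix, and all
   other cells are zero. *)
Definition input_store (n : nat) (A : rel 'I_n) : store :=
  fun x i j =>
    if [&& x == 0, i == 0 & j == 0] then n
    else if x == 1 then
      if (insub i, insub j) is (Some u, Some v) then nat_of_bool (A u v) else 0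
    else 0.

(* Output format: cell 2[0, 0] holds the number of temporal edges, and the
   k-th row (u, v, t) of array 3 is the temporal edge ({u, v}, t); every
   temporal edge is listed exactly once. *)
Definition output_is (n : nat) (s : store) (G : temporal_graph 'I_n) : Prop :=
  exists l : seq ('I_n * 'I_n * nat),
    [/\ perm_eq (tedges G) [seq ([set e.1.1; e.1.2], e.2) | e <- l],
        s 2 0 0 = size l
      & forall k u v t, onth l k = Some (u, v, t) ->
          [/\ s 3 k 0 = u, s 3 k 1 = v & s 3 k 2 = t]].

(* The running time is polynomial in n; the input occupies n ^ 2 + 1 cells. *)
Definition tree_solution_in_poly_time : Prop :=
  exists (p : cmd) (c d : nat), forall (n : nat) (A : rel 'I_n),
    strongly_connected A ->
    (exists G : temporal_graph 'I_n, tree_solution A G) ->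
    exists (t : nat) (s : store) (G : temporal_graph 'I_n),
      [/\ exec p (input_store A) t s,
          t <= c * n ^ d + c,
          output_is s G
        & tree_solution A G].

(* Main.v *)
From mathcomp Require Import all_boot finmap zify.
Require Import Defs.

Set Implicit Arguments.
Unset Strict Implicit.
Unset Printing Implicit Defensive.

(** Fix a root [r] and write [mutual w] for mutual reachability in [R - w].
    A parent function [f] is normal when, for every [x != r], the subtree of [x]
    is the strongly connected component of [x] in [R - f x], and every closed walk
    leaving that component passes through [x].

    - Walk-Helly gives a normal [f]: the component [C] of [x] in [R - p], together
      with the components of [p] in [R - z] for [z] in [C], would be a pairwise
      intersecting family without common vertex if no [z] in [C] were met by all
      closed walks through [p] and [C]. So each component has an eligible root, and
      one recurses into the component minus its root.
    - A normal tree is a tree representation. An arbitrary tree representation need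
      not carry a tree solution, but a normal one does: the neighbours of a vertex
      [w] are partially ordered by reachability in [R - w], every request that
      crosses [w] respects this order, and in a tree such local orders of the edges
      have a common linear extension, which provides the times.
    - Conversely, in a tree solution the times of the edges at [w] increase along a
      walk avoiding [w] each time it changes branch, so a closed walk stays in one
      branch; and subtrees of a tree have the Helly property.

    The normal parent function and the times are both computed by greedy sweeps over
    the vertices, which only query reachability in the digraphs [R - w]. *)

(** * Reachability avoiding a vertex *)

Lemma connect_last (V : finType) (e : rel V) u p x :
  path e u p -> x \in u :: p -> connect e x (last u p).
Proof.
move=> pp xp; case/splitPl: p / xp pp => p1 p2 <-.
rewrite cat_path last_cat => /andP[_ p2p].
by apply/connectP; exists p2.
Qed.

Section Avoiding.
Variables (V : finType) (A : rel V).

Definition avoid (w : V) : rel V := [rel a b | [&& a != w, b != w & A a b]].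
Definition reach (w a b : V) : bool := connect (avoid w) a b.
Definition mutual (w a b : V) : bool := reach w a b && reach w b a.
Definition scc (w a : V) : {set V} := [set u | mutual w u a].

Lemma reach_refl w a : reach w a a.
Proof. exact: connect0. Qed.

Lemma reach_trans w : transitive (reach w).
Proof. exact: connect_trans. Qed.

Lemma reach_arc w a b : a != w -> b != w -> A a b -> reach w a b.
Proof. by move=> aw bw ab; apply: connect1; apply/and3P. Qed.

Lemma reach_neq w a b : reach w a b -> a != w -> b != w.
Proof.
case/connectP=> p; elim: p a => [|c p IH] a /=; first by move=> _ ->.
by case/andP=> /and3P[_ cw _] pc e _; apply: IH pc e cw.
Qed.

Lemma reach_neqV w a b : reach w a b -> b != w -> a != w.
Proof.
case/connectP=> [[|c p]] /=; first by move=> _ ->.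
by case/andP=> /and3P[].
Qed.

Lemma mutual_refl w a : mutual w a a.
Proof. by rewrite /mutual reach_refl. Qed.

Lemma mutual_sym w a b : mutual w a b = mutual w b a.
Proof. exact: andbC. Qed.

Lemma mutual_trans w : transitive (mutual w).
Proof.
move=> b a c /andP[ab ba] /andP[bc cb].
by rewrite /mutual (reach_trans ab bc) (reach_trans cb ba).
Qed.

Lemma mutual_neq w a b : mutual w a b -> b != w -> a != w.
Proof. by case/andP=> ab _; apply: reach_neqV. Qed.

Lemma reach_or w q a b :
  reach w a b -> reach q a b \/ reach w a q /\ reach w q b.
Proof.
case/connectP=> p; elim: p a => [|c p IH] a /=.
  by move=> _ ->; left; apply: reach_refl.
case/andP=> ac pc eb; have rac : reach w a c by apply: connect1.
have [aq|aq] := eqVneq a q.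
  right; rewrite -aq; split; first exact: reach_refl.
  by apply: reach_trans rac _; apply/connectP; exists p.
have [cq|cq] := eqVneq c q.
  by right; rewrite -cq; split=> //; apply/connectP; exists p.
case: (IH c pc eb) => [cb|[c1 c2]]; last first.
  by right; split=> //; apply: reach_trans rac _.
left; apply: reach_trans cb; apply: reach_arc => //.
by case/and3P: ac.
Qed.

(** If one of the two walks meets [q], closing it up with the other puts [q] into the component. *)
Lemma mutual_or w q u z : mutual w u z -> mutual q u z \/ mutual w u q.
Proof.
case/andP=> uz zu.
case: (reach_or q uz) => [uz'|[a b]]; last first.
  by right; rewrite /mutual a /=; apply: reach_trans b zu.
case: (reach_or q zu) => [zu'|[a b]]; last first.
  by right; rewrite /mutual b (reach_trans uz a).
by left; rewrite /mutual uz'.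
Qed.

(** Cut the walk at its first visit to [{x, p}]: the part before it avoids the other of the two
    vertices. *)
Lemma connect_avoid x p v : x != p -> connect A v x -> reach p v x \/ reach x v p.
Proof.
move=> xp /connectP[l]; elim: l v => [|c l IH] v /=.
  by move=> _ <-; left; apply: reach_refl.
case/andP=> vc pc e.
have [->|vx] := eqVneq v x; first by left; apply: reach_refl.
have [->|vp] := eqVneq v p; first by right; apply: reach_refl.
case: (IH c pc e) => cr; [left|right]; apply: reach_trans (cr); apply: reach_arc => //.
  exact: reach_neqV cr xp.
by apply: reach_neqV cr _; rewrite eq_sym.
Qed.

(** Mirror image of [connect_avoid]: keep the part after the last visit to [{x, p}]. *)
Lemma avoid_connect x p u : x != p -> connect A x u -> reach p x u \/ reach x p u.
Proof.
move=> xp /connectP[l]; elim/last_ind: l u => [|l c IH] u /=.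
  by move=> _ ->; left; apply: reach_refl.
rewrite rcons_path last_rcons => /andP[pl lc] ->.
have [->|cx] := eqVneq c x; first by left; apply: reach_refl.
have [->|cp] := eqVneq c p; first by right; apply: reach_refl.
case: (IH _ pl erefl) => cr; [left|right]; apply: reach_trans (cr) _; apply: reach_arc => //.
  exact: reach_neq cr xp.
by apply: reach_neq cr _; rewrite eq_sym.
Qed.

Lemma closed_walk_set_mutual S w x y :
  closed_walk_set A S -> x \in S -> y \in S -> w \notin S -> mutual w x y.
Proof.
case=> u [p [/and3P[_ pp /eqP lp] ->]]; rewrite !inE => xS yS wS.
have {}pp : path (avoid w) u p.
  elim: p u pp wS {lp xS yS} => //= c p IH u /andP[uc pc].
  rewrite !negb_or => /and3P[wu wc wp]; apply/andP; split.
    by apply/and3P; rewrite !(eq_sym _ w).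
  by apply: IH => //; rewrite negb_or wc.
have from z : z \in u :: p -> reach w u z by apply: path_connect pp _.
have to z : z \in u :: p -> reach w z u.
  by move=> zp; rewrite -lp; apply: connect_last pp zp.
by rewrite /mutual (reach_trans (to x xS) (from y yS)) (reach_trans (to y yS) (from x xS)).
Qed.

(** Round trips from [a] to all vertices of the component concatenate to one closed walk; the second
    vertex [b] makes it nonempty. *)
Lemma scc_closed_walk w a b :
  a != w -> b != a -> mutual w b a -> closed_walk_set A (scc w a).
Proof.
move=> aw ba mba.
have cover (l : seq V) : {subset l <= scc w a} ->
    exists p, [/\ path (avoid w) a p, last a p = a & {subset l <= a :: p}].
  elim: l => [|y l IH] sl; first by exists [::].
  have sl' : {subset l <= scc w a} by move=> z zl; apply: sl; rewrite inE zl orbT.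
  have [p [pp lp lsub]] := IH sl'.
  have := sl y (mem_head _ _); rewrite inE => /andP[/connectP[q2 q2p e2] /connectP[q1 q1p e1]].
  exists (p ++ q1 ++ q2); split.
  - by rewrite cat_path pp lp cat_path q1p -e1.
  - by rewrite !last_cat lp -e1 -e2.
  move=> z; rewrite inE => /orP[/eqP->|/lsub]; last first.
    by rewrite !inE mem_cat => /orP[->|->]; rewrite ?orbT.
  have : y \in a :: q1 by rewrite e1 mem_last.
  by rewrite !inE !mem_cat => /orP[->|->]; rewrite ?orbT.
have all_scc : {subset enum (scc w a) <= scc w a} by move=> z; rewrite mem_enum.
have [p [pp lp sub]] := cover _ all_scc.
exists a, p; split.
  apply/and3P; split; last by rewrite lp.
    case: p pp lp sub => // _ _ /(_ b).
    by rewrite mem_enum !inE (negbTE ba) => /(_ mba).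
  by apply: sub_path pp => x y /and3P[].
apply/setP=> z; rewrite [RHS]inE; apply/idP/idP => [zS|zp].
  by apply: sub; rewrite mem_enum.
have az : reach w a z := path_connect pp zp.
rewrite inE /mutual az andbT.
by rewrite -[X in reach _ _ X]lp; apply: connect_last pp zp.
Qed.

End Avoiding.

(** * Greedy construction of a normal parent function *)

Section Greedy.
Variables (V : finType) (St : Type) (step : St -> V -> St).
Variables (Inv : St -> Prop) (done : St -> {set V}).

Definition sweep (s : St) : St := foldl step s (enum V).

Hypothesis stepI : forall s v, Inv s -> Inv (step s v).
Hypothesis step_done : forall s v, step s v = s \/ done s \proper done (step s v).
Hypothesis progress :
  forall s, Inv s -> done s != setT -> exists v, done (step s v) != done s.

Lemma foldl_step_inv s l : Inv s -> Inv (foldl step s l).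
Proof. by elim: l s => //= v l IH s /(@stepI _ v); apply: IH. Qed.

Lemma foldl_step_sub s l : done s \subset done (foldl step s l).
Proof.
elim: l s => //= v l IH s; apply: subset_trans (IH _).
by case: (step_done s v) => [->|/proper_sub].
Qed.

(** A step is the identity or enlarges [done], and [done] never shrinks; so a pass that leaves
    [done] as it was changed nothing at all. *)
Lemma foldl_step_stuck s l v :
  done (foldl step s l) = done s -> v \in l -> step s v = s.
Proof.
elim: l => //= a l IH.
case: (step_done s a) => [E|/proper_card lt].
  by rewrite E inE => /IH{}IH /orP[/eqP->|/IH].
by move=> eqd; have /subset_leq_card := foldl_step_sub (step s a) l; rewrite eqd; lia.
Qed.

Lemma sweep_card s : Inv s -> done s != setT -> #|done s| < #|done (sweep s)|.
Proof.
move=> Is nT; rewrite proper_card // properEneq foldl_step_sub andbT.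
apply/eqP=> eqd; have [v] := progress Is nT.
by rewrite (foldl_step_stuck (esym eqd)) ?eqxx // mem_enum.
Qed.

(** Every sweep before completion enlarges [done], so [#|V|] sweeps suffice. Their fixed number
    later allows two nested bounded loops. *)
Lemma sweeps_done s :
  Inv s -> Inv (iter #|V| sweep s) /\ done (iter #|V| sweep s) = setT.
Proof.
move=> Is; have Ik k : Inv (iter k sweep s).
  by elim: k => //= k; apply: foldl_step_inv.
split=> //; apply/eqP; rewrite eqEcard subsetT cardsT /=.
suff : forall k, k <= #|V| -> k <= #|done (iter k sweep s)| by apply.
elim=> // k IH kV /=; have {}IH := IH (ltnW kV).
have [dT|dT] := eqVneq (done (iter k sweep s)) setT; last first.
  by apply: leq_ltn_trans IH _; apply: sweep_card.
have /subset_leq_card := foldl_step_sub (iter k sweep s) (enum V).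
by rewrite -/(sweep _) dT cardsT; apply: leq_trans.
Qed.

End Greedy.

(** * Rooting the components one after the other *)

Section ParentTree.
Variables (V : finType) (A : rel V) (r : V).

Definition subtree (f : V -> V) (x : V) : {set V} := scc A (f x) x.

(** A closed walk leaving the component of [x] in [R - f x] meets [f x]; so the clause
    [~~ mutual A x u (f x)] forces it through [x]. *)
Definition normal (f : V -> V) : Prop :=
  f r = r /\ forall x, x != r ->
  [/\ f x != x,
      forall u, u \in subtree f x -> u != x ->
        [/\ u != r, f u \in subtree f x & ~~ mutual A x u (f x)]
    & forall u, u != r -> f u \in subtree f x -> subtree f u \subset subtree f x].

Definition ready (f : V -> V) (v : V) : bool :=
  [forall u, [&& u != v & mutual A (f v) u v] ==> ~~ mutual A v u (f v)].

Definition settle (f : V -> V) (v : V) : {ffun V -> V} :=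
  [ffun u => if (u != v) && mutual A (f v) u v then v else f u].

Definition tree_step (s : {ffun V -> V} * {set V}) (v : V) :=
  if (v \notin s.2) && ready s.1 v then (settle s.1 v, v |: s.2) else s.

(* In a state [(f, D)] the vertices in [D] are settled, and [f x] for [x] outside [D]
   is the settled vertex below which the component of [x] still has to be rooted. *)
Definition tree_inv (s : {ffun V -> V} * {set V}) : Prop :=
  let: (f, D) := s in
  [/\ r \in D /\ f r = r,
      forall x, x != r -> f x \in D /\ f x != x,
      forall x u, x \notin D -> u \in subtree f x -> u \notin D /\ f u = f x,
      forall x u, x \in D -> x != r -> u \in subtree f x -> u != x ->
        [/\ u != r, f u \in subtree f x & ~~ mutual A x u (f x)]
    & forall x u, x \in D -> x != r -> u != r -> f u \in subtree f x ->
        subtree f u \subset subtree f x].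

Lemma mem_subtree f x : x \in subtree f x.
Proof. by rewrite inE mutual_refl. Qed.

Lemma tree_inv0 : tree_inv ([ffun=> r], [set r]).
Proof.
split.
- by rewrite !inE ffunE.
- by move=> x xr; rewrite ffunE inE eqxx eq_sym.
- move=> x u; rewrite !inE !ffunE => xr ux; split=> //.
  exact: mutual_neq ux xr.
- by move=> x u; rewrite inE => ->.
- by move=> x u; rewrite inE => ->.
Qed.

(** Only the component of [v] in [R - f v] is affected. Its other vertices get their components in
    [R - v] as subtrees, and readiness keeps these inside the old component, so subtrees stay
    nested. *)
Lemma tree_step_inv s v : tree_inv s -> tree_inv (tree_step s v).
Proof.
rewrite /tree_step; case: s => f D /=; case: ifP => // /andP[vD /forallP rdy].
move=> [[rD fr] i1 i2 i34 i8].
have vr : v != r by apply: contraNneq vD => ->.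
have [pD pv] := i1 v vr; set p := f v in pD pv rdy.
have {}rdy u : u != v -> u \in subtree f v -> ~~ mutual A v u p.
  by move=> uv; rewrite inE => us; have := rdy u; rewrite uv us.
have CD u : u \in subtree f v -> u \notin D /\ f u = p by apply: i2.
set f' := settle f v.
have f'in u : u != v -> u \in subtree f v -> f' u = v.
  by rewrite ffunE inE => -> ->.
have f'out u : u \notin subtree f v -> f' u = f u.
  by rewrite ffunE inE => /negbTE->; rewrite andbF.
have f'v : f' v = p by rewrite ffunE eqxx.
have f'D u : u \in D -> f' u = f u.
  by move=> uD; apply: f'out; apply: contraL uD => /CD[].
have subD x : x \in D -> subtree f' x = subtree f x by move=> xD; rewrite /subtree f'D.
have subout x : x \notin subtree f v -> subtree f' x = subtree f x by move=> xD; rewrite /subtree f'out.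
have subv : subtree f' v = subtree f v by rewrite /subtree f'v.
(* By [mutual_or], either [z] and [x] share a component of [R - p], or the component of [z] and [x]
   in [R - v] contains [p], against readiness. *)
have subin x : x != v -> x \in subtree f v -> subtree f' x \subset subtree f v :\ v.
  move=> xv xC; apply/subsetP=> z; rewrite !inE f'in // => zx.
  have zv := mutual_neq zx xv; rewrite zv /=.
  case: (mutual_or p zx) => [zp|vp].
    by apply: mutual_trans zp _; move: xC; rewrite inE.
  by case/negP: (rdy x xv xC); apply: mutual_trans vp; rewrite mutual_sym.
split.
- by rewrite !inE rD orbT f'D.
- move=> x xr; have [fxD fxx] := i1 x xr.
  have [->|xv] := eqVneq x v; first by rewrite f'v !inE pD orbT.
  have [xC|xC] := boolP (x \in subtree f v).
    by rewrite f'in // !inE eqxx eq_sym.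
  by rewrite f'out // !inE fxD orbT.
- move=> x u; rewrite !in_setU1 !negb_or => /andP[xv xD].
  have [xC|xC] := boolP (x \in subtree f v).
    move=> /(subsetP (subin x xv xC)).
    by rewrite in_setD1 => /andP[uv uC]; rewrite uv !f'in //; case: (CD u uC).
  rewrite subout // => ux; have [uD fux] := i2 x u xD ux.
  have uC : u \notin subtree f v.
    apply: contra xC => uC; have [_ fup] := CD u uC.
    move: ux uC; rewrite /subtree -fux fup !inE => ux uC.
    by apply: mutual_trans uC; rewrite mutual_sym.
  by rewrite !f'out // uD andbT; split=> //; apply: contraNneq uC => ->; apply: mem_subtree.
- move=> x u; rewrite in_setU1 => /orP[/eqP->|xD] xr.
    rewrite subv f'v => uC uv; rewrite f'in // mem_subtree rdy //; split=> //.
    by have [uD _] := CD u uC; apply: contraNneq uD => ->.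
  rewrite subD // (f'D x) // => ux uxn; have [ur fux nm] := i34 x u xD xr ux uxn.
  split=> //; have [uC|uC] := boolP (u \in subtree f v); last by rewrite f'out.
  have [->|uv] := eqVneq u v; first by rewrite f'v; have [_ <-] := CD u uC.
  rewrite f'in //; have [_ fup] := CD u uC.
  by apply: (subsetP (i8 x v xD xr vr _)); rewrite ?mem_subtree // -/p -fup.
- move=> x u; rewrite in_setU1 => /orP[/eqP->|xD] xr ur.
    rewrite subv; have [->|uv] := eqVneq u v.
      by rewrite subv.
    have [uC|uC] := boolP (u \in subtree f v).
      by move=> _; apply: subset_trans (subin u uv uC) _; apply: subD1set.
    rewrite f'out // => /CD[].
    by have [-> _] := i1 u ur.
  rewrite subD //; have [->|uv] := eqVneq u v.
    by rewrite f'v subv; apply: i8.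
  have [uC|uC] := boolP (u \in subtree f v); last by rewrite f'out // subout //; apply: i8.
  rewrite f'in // => vx.
  apply: subset_trans (subin u uv uC) _; apply: subset_trans (subD1set _ _) _.
  apply: i8 => //; have xv : v != x by apply: contraNneq vD => ->.
  by have [] := i34 x v xD xr vx xv.
Qed.

Lemma tree_step_done (s : {ffun V -> V} * {set V}) v :
  tree_step s v = s \/ s.2 \proper (tree_step s v).2.
Proof.
rewrite /tree_step; case: ifP => [/andP[vD _]|_]; [right|by left].
by rewrite /= setUC properUl // sub1set.
Qed.

(** If every [z] in [C] had a bad [u], then [C] would meet each [scc A z p], and any two of these
    share [p]. A common vertex [z] would lie in [C], hence also in [scc A z p], which omits [z]. The
    bad vertices also show that these sets have two elements, so they come from closed walks. *)
Lemma helly_ready f x : walk_helly A -> f x != x ->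
  exists2 v, v \in subtree f x & (f v = f x -> ready f v).
Proof.
move=> hA fx; set p := f x; set C := subtree f x.
have pC : p \notin C by rewrite inE; apply/negP=> /mutual_neq; rewrite eq_sym fx eqxx => /(_ isT).
pose bad z u := [&& u \in C, u != z & mutual A z u p].
have [/existsP[z /andP[zC /existsPn gz]]|/existsPn all_bad] :=
  boolP [exists z, (z \in C) && ~~ [exists u, bad z u]].
  exists z => // fz; apply/forallP=> u; apply/implyP; rewrite fz => /andP[uz uzm].
  apply/negP=> um; case/negP: (gz u); rewrite /bad uz um !andbT inE.
  by apply: mutual_trans uzm _; move: zC; rewrite inE.
have {}all_bad z : z \in C -> exists2 u, u \in C & (u != z) && mutual A z u p.
  move=> zC; have := all_bad z; rewrite zC /= negbK => /existsP[u /andP[uC ub]].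
  by exists u.
have zp z : z \in C -> p != z by apply: contraTneq => <-.
have [y|S S'|z Hz] := hA (C |: [set scc A z p | z in C]).
- rewrite in_setU1 => /orP[/eqP->|/imsetP[z zC ->]].
    have [u uC /andP[ux _]] := all_bad x (mem_subtree f x).
    apply: (@scc_closed_walk _ _ _ _ u) => //; first by rewrite eq_sym.
    by move: uC; rewrite inE.
  have [u uC /andP[uz um]] := all_bad z zC.
  by apply: (@scc_closed_walk _ _ _ _ u) => //; [apply: zp|rewrite eq_sym; apply: zp].
- have meet z : z \in C -> C :&: scc A z p != set0.
    move=> zC; have [u uC /andP[_ um]] := all_bad z zC.
    by apply/set0Pn; exists u; rewrite inE uC inE.
  rewrite !in_setU1 => /orP[/eqP->|/imsetP[z zC ->]] /orP[/eqP->|/imsetP[z' zC' ->]].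
  + by apply/set0Pn; exists x; rewrite inE mem_subtree.
  + exact: meet.
  + by rewrite setIC; apply: meet.
  by apply/set0Pn; exists p; rewrite !inE !mutual_refl.
have zC : z \in C by apply: Hz; rewrite setU11.
have : z \in scc A z p.
  by apply: Hz; rewrite in_setU1; apply/orP; right; apply/imsetP; exists z.
by rewrite inE => /mutual_neq; rewrite zp // eqxx => /(_ isT).
Qed.

Definition tree_sweeps : {ffun V -> V} * {set V} :=
  iter #|V| (sweep tree_step) ([ffun=> r], [set r]).

Lemma tree_progress s : walk_helly A -> tree_inv s -> s.2 != setT ->
  exists v, (tree_step s v).2 != s.2.
Proof.
case: s => f D hA [[rD _] i1 i2 _ _] /= DT.
have [x xD] : exists x, x \notin D.
  apply/existsP; apply: contraNT DT => /existsPn h; apply/eqP/setP=> x.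
  by rewrite inE; apply/negPn/h.
have xr : x != r by apply: contraNneq xD => ->.
have [v vx rdy] := helly_ready hA (i1 x xr).2.
have [vD /rdy rv] := i2 x v xD vx; exists v; rewrite /tree_step /= vD rv /=.
by apply: contraNneq vD => <-; apply: setU11.
Qed.

Lemma tree_sweeps_normal : walk_helly A -> normal tree_sweeps.1.
Proof.
move=> hA; have [] := @sweeps_done _ _ tree_step tree_inv snd tree_step_inv
  tree_step_done (fun s => @tree_progress s hA) _ tree_inv0.
rewrite -/tree_sweeps; case: tree_sweeps => f D /= [[rD fr] i1 i2 i34 i8] DT.
split=> // x xr; have xD : x \in D by rewrite DT inE.
split; [by case: (i1 x xr)|by move=> u; apply: i34|by move=> u; apply: i8].
Qed.

End ParentTree.

(** * Rooted trees and the Helly property *)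

(** The condition [a != b] removes the loop at the root, which is its own parent. *)
Definition parent_rel (V : finType) (f : V -> V) : rel V :=
  [rel a b | (a != b) && ((f a == b) || (f b == a))].

Lemma parent_rel_sym (V : finType) (f : V -> V) : symmetric (parent_rel f).
Proof. by move=> a b; rewrite /parent_rel /= eq_sym orbC. Qed.

Section Rooted.
Variables (V : finType) (r : V) (f : V -> V) (d : V -> nat).
Hypothesis fr : f r = r.
Hypothesis df : forall x, x != r -> d (f x) < d x.

(** Connectedness in terms of parents. Because [f r = r], the clause [x != r] is what keeps the root
    from occurring below the top. *)
Definition topped (S : {set V}) (t : V) : bool :=
  (t \in S) && [forall x in S, (x != t) ==> (x != r) && (f x \in S)].

Lemma toppedP (S : {set V}) t : reflect
  (t \in S /\ forall x, x \in S -> x != t -> x != r /\ f x \in S) (topped S t).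
Proof.
apply: (iffP andP) => -[tS h]; split=> //.
  by move=> x xS xt; have /implyP/(_ xS)/implyP/(_ xt)/andP := forallP h x.
by apply/forallP=> x; apply/implyP=> xS; apply/implyP=> xt; apply/andP; apply: h.
Qed.

Lemma topped_setT : topped [set: V] r.
Proof. by apply/toppedP; split=> // x _ xr; rewrite inE. Qed.

Lemma topped_depth (S : {set V}) t z : topped S t -> z \in S -> z != t -> d t < d z.
Proof.
case/toppedP=> tS h; have [m] := ubnP (d z); elim: m z => // m IH z zm zS zt.
have [zr fz] := h z zS zt; have lt := df zr.
have [<-//|ft] := eqVneq (f z) t.
exact: ltn_trans (IH _ (leq_trans lt zm) fz ft) lt.
Qed.

Lemma topped_connected S t : topped S t -> connected_on (parent_rel f) S.
Proof.
case/toppedP=> tS h.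
pose e := [rel a b | [&& a \in S, b \in S & parent_rel f a b]].
have es : connect_sym e.
  by apply: sym_connect_sym => a b; rewrite /e /= parent_rel_sym andbCA.
have climb z : z \in S -> connect e z t.
  have [m] := ubnP (d z); elim: m z => // m IH z zm zS.
  have [->|zt] := eqVneq z t; first exact: connect0.
  have [zr fz] := h z zS zt; have lt := df zr.
  apply: connect_trans (IH (f z) (leq_trans lt zm) fz).
  apply: connect1; rewrite /e /= zS fz /parent_rel /= eqxx andbT.
  by apply/eqP=> zf; move: lt; rewrite -zf ltnn.
by move=> x y xS yS; apply: (connect_trans (climb x xS)); rewrite es; apply: climb.
Qed.

Lemma parent_up a b : parent_rel f a b -> d b <= d a -> b = f a.
Proof.
case/andP=> ab /orP[/eqP//|/eqP fb].
have br : b != r by apply: contraNneq ab => br; rewrite -fb br fr.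
by have := df br; rewrite fb; lia.
Qed.

(** A deepest vertex of a cycle would have its parent as both neighbours, repeating a vertex. *)
Lemma parent_is_tree : is_tree (parent_rel f).
Proof.
split; first exact: parent_rel_sym.
- by move=> a; rewrite /parent_rel /= eqxx.
- exact: topped_connected topped_setT.
move=> c sc /andP[cc uc].
have [x0 x0c] : exists x0, x0 \in c by case: c sc {cc uc} => // x0 c _; exists x0; apply: mem_head.
case: (@arg_maxnP _ x0 (fun x => x \in c) d x0c) => x xc xmax.
have [i c' def_c] := rot_to xc.
move: sc cc uc; rewrite -(size_rot i) -(rot_cycle i) -(rot_uniq i) def_c.
have {}xmax y : y \in c' -> d y <= d x.
  by move=> yc; apply: xmax; rewrite -(mem_rot i) def_c inE yc orbT.
case: c' def_c xmax => [|y [|z c']] // _ xmax _.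
rewrite [cycle _ _]/= rcons_path => /and3P[xy _ /andP[_ lx]] /and3P[_ yn _].
have ey := parent_up xy (xmax y (mem_head _ _)).
have lz : last z c' \in z :: c' by apply: mem_last.
have el : last z c' = f x.
  apply: parent_up; first by rewrite parent_rel_sym.
  by apply: xmax; rewrite inE lz orbT.
by move: yn; rewrite ey -el lz.
Qed.

(** A deepest top [t] lies in every member: from a vertex common to [S] and [S'], climbing stays in
    both until it reaches [t], because the top of [S'] is not deeper than [t]. *)
Lemma topped_helly (F : {set V} -> Prop) :
  (forall S, F S -> exists t, topped S t) -> helly F.
Proof.
move=> hF H HF Hmeet.
have [->|[S0 S0H]] := set_0Vmem H; first by exists r => S; rewrite inE.
have [t0 t0S] := hF _ (HF _ S0H).
pose P (q : {set V} * V) := (q.1 \in H) && topped q.1 q.2.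
have P0 : P (S0, t0) by rewrite /P S0H.
case: (@arg_maxnP _ (S0, t0) P (fun q => d q.2) P0) => -[S t] /andP[/= SH tS] tmax.
exists t => S' S'H; have [t' t'S] := hF _ (HF _ S'H).
have le : d t' <= d t by apply: (tmax (S', t')); apply/andP.
have /set0Pn[z] := Hmeet S S' SH S'H; rewrite inE => /andP[].
have [m] := ubnP (d z); elim: m z => // m IH z zm zS zS'.
have [<-//|zt] := eqVneq z t.
have dz := topped_depth tS zS zt.
have zt' : z != t' by apply: contraTneq dz => ->; rewrite -leqNgt.
have [zr fz] := (toppedP _ _ tS).2 z zS zt.
have [_ fz'] := (toppedP _ _ t'S).2 z zS' zt'.
exact: (IH (f z) (leq_trans (df zr) zm) fz fz').
Qed.

Lemma fconnect_up u x : fconnect f u x -> u != x -> fconnect f (f u) x.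
Proof.
case/connectP=> -[|c p] /=; first by move=> _ -> /eqP.
by case/andP=> /eqP<- pc ex _; apply/connectP; exists p.
Qed.

Lemma depth_parent u : d (f u) <= d u.
Proof. by have [->|/df/ltnW//] := eqVneq u r; rewrite fr. Qed.

Lemma fconnect_depth u x : fconnect f u x -> u != x -> d x < d u.
Proof.
case/connectP=> p; elim: p u => [|c p IH] u /=; first by move=> _ -> /eqP.
case/andP=> /eqP<- pc ex ux.
have le : d x <= d (f u).
  by have [<-//|fux] := eqVneq (f u) x; apply/ltnW/IH.
have [ur|ur] := eqVneq u r; last by apply: leq_ltn_trans le (df ur).
have fux : f u != x by rewrite ur fr -ur.
by apply: leq_trans (IH _ pc ex fux) (depth_parent u).
Qed.

Lemma fconnect_root_all u : fconnect f u r.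
Proof.
have [m] := ubnP (d u); elim: m u => // m IH u um.
have [->|ur] := eqVneq u r; first exact: connect0.
by apply: connect_trans (IH (f u) (leq_trans (df ur) um)); apply: connect1; apply/eqP.
Qed.

(** The top is a shallowest vertex [t]. The only edge out of the descendants of [x] leads to [f x];
    were [f x] outside [S], a path in [S] from [x] would make [t] a descendant of [x], hence
    deeper. *)
Lemma connected_on_topped (S : {set V}) t0 :
  t0 \in S -> connected_on (parent_rel f) S -> exists t, topped S t.
Proof.
move=> t0S cS; case: (@arg_minnP _ t0 (fun x => x \in S) d t0S) => t tS tmin.
exists t; apply/toppedP; split=> // x xS xt.
have notdesc : ~~ fconnect f t x.
  apply/negP=> /fconnect_depth; rewrite eq_sym => /(_ xt).
  by rewrite ltnNge tmin.
split; first by apply: contraNneq notdesc => ->; apply: fconnect_root_all.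
apply: contraNT notdesc => fxS.
have stay p u : path [rel a b | [&& a \in S, b \in S & parent_rel f a b]] u p ->
    fconnect f u x -> fconnect f (last u p) x.
  elim: p u => [|c p IH] u //= /andP[/and4P[uS cS' uc /orP[/eqP fu|/eqP fc]] pc] ux.
    apply: IH pc _; rewrite -fu; apply: fconnect_up => //.
    by apply: contraNneq fxS => <-; rewrite fu.
  by apply: IH pc _; apply: connect_trans ux; apply: connect1; apply/eqP.
by case/connectP: (cS x t xS tS) => p pp ->; apply: stay pp _; apply: connect0.
Qed.

End Rooted.

(** Breadth-first search: [d] is the distance from [r], and [f] picks a closer predecessor. *)
Lemma connected_parent (V : finType) (E : rel V) (r : V) :
  (forall x, connect E r x) ->
  exists (f : V -> V) (d : V -> nat),
    f r = r /\ forall x, x != r -> E (f x) x /\ d (f x) < d x.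
Proof.
move=> hc; pose P x k := [exists p : k.-tuple V, path E r p && (last r p == x)].
have hP x : exists k, P x k.
  case/connectP: (hc x) => p pp ex; exists (size p).
  by apply/existsP; exists (in_tuple p); rewrite pp -ex eqxx.
pose d x := ex_minn (hP x).
have pred x : x != r -> exists y, E y x && (d y < d x).
  move=> xr; rewrite {2}/d; case: ex_minnP => k /existsP[p] + _.
  case: p => p /= /eqP sp /andP[]; case/lastP: p sp => [|p y] sp.
    by rewrite eq_sym (negbTE xr).
  rewrite last_rcons rcons_path => /andP[pp ly] /eqP yx.
  exists (last r p); rewrite -yx ly -sp size_rcons ltnS /=.
  rewrite /d; case: ex_minnP => k' _; apply.
  by apply/existsP; exists (in_tuple p); rewrite pp eqxx.
pose f x := if x == r then r else odflt r [pick y | E y x && (d y < d x)].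
exists f, d; split; first by rewrite /f eqxx.
move=> x xr; rewrite /f (negbTE xr).
case: pickP => [y /andP[]//|no]; have [y] := pred x xr.
by rewrite no.
Qed.

Definition minus_edge (V : finType) (T : rel V) (a b : V) : rel V :=
  [rel x y | T x y && ~~ ((x == a) && (y == b) || (x == b) && (y == a))].

(** Otherwise a path and the edge close up to a cycle. It has at least three vertices, as [a]
    differs from [b] and the single edge was removed. *)
Lemma tree_edge_bridge (V : finType) (T : rel V) a b : is_tree T -> T a b ->
  ~~ connect (minus_edge T a b) a b.
Proof.
case=> Ts Ti _ Tc ab; apply/negP=> /connectP[p0 pp0 eb]; move: pp0 eb.
case/shortenP=> p pp up _ eb.
have ba : b != a by apply: contraTneq ab => ->; rewrite Ti.
apply: (Tc (a :: p)).
  case: p pp eb {up} => [|c [|c' p]] //=; first by move=> _ eb; rewrite eb eqxx in ba.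
  by rewrite andbT => /andP[_ nc] eb; rewrite eb !eqxx in nc.
rewrite /ucycle up andbT /= rcons_path -eb Ts ab andbT.
by apply: sub_path pp => x y /andP[].
Qed.

(** Breadth-first parents use edges of [T] only. If an edge of [T] joined no vertex to its parent,
    both its ends could climb to [r] without it, against [tree_edge_bridge]. *)
Lemma tree_parent (V : finType) (T : rel V) (r : V) : is_tree T ->
  exists (f : V -> V) (d : V -> nat),
    [/\ f r = r, forall x, x != r -> d (f x) < d x & T =2 parent_rel f].
Proof.
move=> tT; have [Ts Ti Tc _] := tT.
have [|f [d [fr fd]]] := @connected_parent V T r.
  move=> x; have := Tc r x (in_setT _) (in_setT _).
  by apply: connect_sub => u v /= /and3P[_ _ uv]; apply: connect1.
exists f, d; split=> // [x /fd[]//|a b].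
have par x : f x != x -> T (f x) x.
  by move=> fx; have /fd[] : x != r by apply: contraNneq fx => ->; rewrite fr.
apply/idP/idP => [ab|/= /andP[ab /orP[/eqP fa|/eqP fb]]]; last 2 first.
- by rewrite Ts -fa par // fa eq_sym.
- by rewrite -fb par // fb.
have nab : a != b by apply: contraTneq ab => ->; rewrite Ti.
rewrite /parent_rel /= nab; apply: contraT; rewrite negb_or => /andP[fab fba].
have := tree_edge_bridge tT ab; set e := minus_edge T a b.
have es : connect_sym e.
  apply: sym_connect_sym => x y; rewrite /e /minus_edge /= Ts; congr (_ && ~~ _).
  by rewrite orbC ![(y == _) && _]andbC.
have climb x : connect e x r.
  have [m] := ubnP (d x); elim: m x => // m IH x xm.
  have [->|xr] := eqVneq x r; first exact: connect0.
  have [Tx dx] := fd x xr.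
  apply: connect_trans (IH (f x) (leq_trans dx xm)); apply: connect1.
  rewrite /e /minus_edge /= Ts Tx /=; apply/norP; split.
    by apply/negP=> /andP[/eqP-> fa]; rewrite fa in fab.
  by apply/negP=> /andP[/eqP-> fb]; rewrite fb in fba.
by rewrite (connect_trans (climb a)) // es.
Qed.

Lemma closed_walk_set_neq0 (V : finType) (A : rel V) S : closed_walk_set A S ->
  exists x, x \in S.
Proof. by case=> u [p [_ ->]]; exists u; rewrite inE mem_head. Qed.

Lemma tree_representation_helly (V : finType) (A T : rel V) :
  0 < #|V| -> tree_representation A T -> walk_helly A.
Proof.
case/card_gt0P=> r _ [tT rep].
have [f [d [fr fd eT]]] := tree_parent r tT.
apply: (topped_helly fd) => S FS; have [t0 t0S] := closed_walk_set_neq0 FS.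
apply: (connected_on_topped fr fd t0S) => x y xS yS.
rewrite -(eq_connect (e := [rel a b | [&& a \in S, b \in S & T a b]])); first exact: rep.
by move=> a b; rewrite /= eT.
Qed.

(** * Tree representations and tree solutions *)

Section NormalTree.
Variables (V : finType) (A : rel V) (r : V) (f : V -> V).
Hypothesis nf : normal A r f.

Local Notation sub := (subtree A f).

(** A rank rather than a distance: subtrees shrink strictly from parent to child, so their
    complements grow. *)
Definition depth (x : V) : nat := if x == r then 0 else #|~: sub x|.

Lemma normal_fix : f r = r.
Proof. by case: nf. Qed.

Lemma normal_neq x : x != r -> f x != x.
Proof. by case: nf => _ h /h[]. Qed.

Lemma sub_above x u : x != r -> u \in sub x -> u != x ->
  [/\ u != r, f u \in sub x & ~~ mutual A x u (f x)].
Proof. by case: nf => _ h /h[_ h' _]; apply: h'. Qed.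

Lemma sub_incl x u : x != r -> u != r -> f u \in sub x -> sub u \subset sub x.
Proof. by case: nf => _ h /h[_ _]; apply. Qed.

Lemma parent_notin x : x != r -> f x \notin sub x.
Proof.
move/normal_neq=> fx; rewrite inE; apply/negP=> /mutual_neq.
by rewrite eq_sym fx eqxx => /(_ isT).
Qed.

Lemma root_notin x : x != r -> r \notin sub x.
Proof.
move=> xr; apply/negP=> rx; have rnx : r != x by rewrite eq_sym.
by have [] := sub_above xr rx rnx; rewrite eqxx.
Qed.

Lemma sub_parent x : x != r -> f x != r -> sub x \subset sub (f x).
Proof. by move=> xr fxr; apply: (sub_incl fxr xr); apply: mem_subtree. Qed.

Lemma depth_lt x : x != r -> depth (f x) < depth x.
Proof.
move=> xr; rewrite /depth (negbTE xr); case: eqP => [_|/eqP fxr].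
  by apply/card_gt0P; exists (f x); rewrite inE parent_notin.
apply: proper_card; rewrite properC; apply/properP; split; first exact: sub_parent.
by exists (f x); [apply: mem_subtree|apply: parent_notin].
Qed.

(** Let [t] be a shallowest vertex of [S]. If [f x] is not in [S], the walk lies in [sub x]; as
    [f t] is then not in [S] either, it also lies in [sub t]. So [f x] is in [sub t], which is
    inside [sub x], although no subtree contains the parent of its root. *)
Lemma normal_topped S : closed_walk_set A S -> exists t, topped r f S t.
Proof.
move=> cS; have [t0 t0S] := closed_walk_set_neq0 cS.
case: (@arg_minnP _ t0 (fun x => x \in S) depth t0S) => t tS tmin.
exists t; apply/toppedP; split=> // x xS xt.
have within y : y \in S -> f y \notin S -> S \subset sub y.
  move=> yS fy; apply/subsetP=> z zS; rewrite inE.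
  exact: closed_walk_set_mutual cS zS yS fy.
have xr : x != r.
  apply: contraNneq xt => xr; rewrite xr in xS *; apply: contraT; rewrite eq_sym => tr.
  by have := depth_lt tr; have := tmin r xS; rewrite [depth r]/depth eqxx; lia.
split=> //; apply: contraT => fx; have Sx := within x xS fx.
have tx : t != x by rewrite eq_sym.
have [tr ftx _] := sub_above xr (subsetP Sx t tS) tx.
have ft : f t \notin S by apply/negP=> /tmin; rewrite leqNgt depth_lt.
have St := within t tS ft.
have [_ fxt _] := sub_above tr (subsetP St x xS) xt.
by case/negP: (parent_notin xr); apply: (subsetP (sub_incl xr tr ftx)).
Qed.

Lemma normal_tree_representation : tree_representation A (parent_rel f).
Proof.
split; first exact: parent_is_tree normal_fix depth_lt.
by move=> S /normal_topped[t tS]; apply: topped_connected tS; apply: depth_lt.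
Qed.

End NormalTree.

Section Journeys.
Variables (V : finType) (G : temporal_graph V).

Lemma journey_nil u v : journey G u v [::] = (u == v).
Proof. by rewrite /journey /= eqseq_cons andbT. Qed.

Lemma journey_cons u v s j : journey G u v (s :: j) =
  [&& ([set s.1.1; s.1.2], s.2) \in tedges G, s.1.1 == u,
      all (ltn s.2) [seq s.2 | s <- j] & journey G s.1.2 v j].
Proof.
rewrite /journey /= eqseq_cons (eq_sym u) (path_sortedE ltn_trans).
by case: (_ \in _) => //=; case: (_ == u); rewrite ?andbF //= -andbA andbCA.
Qed.

Definition footprint : rel V := [rel a b | has (fun e => e.1 == [set a; b]) (tedges G)].

Lemma journey_connect u v j : journey G u v j -> connect footprint u v.
Proof.
elim: j u => [|s j IH] u; first by rewrite journey_nil => /eqP->; apply: connect0.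
rewrite journey_cons => /and4P[es /eqP<- _ /IH]; apply: connect_trans.
by apply: connect1; apply/hasP; exists ([set s.1.1; s.1.2], s.2).
Qed.

End Journeys.

Lemma set2_eq (V : finType) (a b x y : V) : [set a; b] = [set x; y] ->
  a = x /\ b = y \/ a = y /\ b = x.
Proof.
move=> e; have : a \in [set x; y] by rewrite -e set21.
have : b \in [set x; y] by rewrite -e set22.
have : x \in [set a; b] by rewrite e set21.
have : y \in [set a; b] by rewrite e set22.
by rewrite !inE => /orP[]/eqP ? /orP[]/eqP ? /orP[]/eqP ? /orP[]/eqP ?;
  first [left; split; congruence | right; split; congruence].
Qed.

(** The edges to the parents already give [n - 1] distinct temporal edges, so there are no others
    and each tree edge has a single time. *)
Lemma tree_solution_rooted (V : finType) (A : rel V) (G : temporal_graph V) (r : V) :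
  strongly_connected A -> tree_solution A G ->
  exists (f : V -> V) (d lam : V -> nat),
    [/\ f r = r, forall x, x != r -> d (f x) < d x &
        forall e, e \in tedges G -> exists2 x, x != r & e = ([set x; f x], lam x)].
Proof.
move=> [_ sc] [sol card].
have [|f [d [fr fd]]] := @connected_parent V (footprint G) r.
  move=> x; have := sc r x; apply: connect_sub => u v /sol[j].
  exact: journey_connect.
pose E := tedges G : seq _.
(* The first listed time of the edge to the parent; for [x != r] the default is never read. *)
pose lam x := (nth (set0, 0) E (find (fun e => e.1 == [set f x; x]) E)).2.
have lamE x : x != r -> ([set x; f x], lam x) \in E.
  move=> xr; have [hx _] := fd x xr.
  have eE : nth (set0, 0) E (find (fun e => e.1 == [set f x; x]) E) \in E.
    by rewrite mem_nth // -has_find.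
  have /eqP := nth_find (set0, 0) hx; move: eE; rewrite /lam.
  by case: (nth _ _ _) => e t /= etE ee; rewrite setUC -ee.
exists f, d, lam; split=> // [x /fd[]//|e eG].
pose L := [seq ([set x; f x], lam x) | x <- enum (predC1 r)].
have uL : uniq L.
  rewrite map_inj_in_uniq ?enum_uniq // => x y.
  rewrite !mem_enum !inE => xr yr [/set2_eq[[]//|[xy yx]] _].
  by have [_] := fd x xr; have [_] := fd y yr; rewrite -xy yx; lia.
have sL : {subset L <= E}.
  by move=> _ /mapP[x + ->]; rewrite mem_enum => /lamE.
have szL : size E <= size L.
  by rewrite size_map -cardE cardC1 -card.
have [_ eL] := uniq_min_size uL sL szL.
have : e \in L by rewrite eL.
by case/mapP=> x; rewrite mem_enum => xr ->; exists x.
Qed.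

(** * Branches of a rooted tree at a vertex *)

Section Branches.
Variables (V : finType) (G : temporal_graph V) (r : V) (f : V -> V) (d lam : V -> nat).
Hypothesis fr : f r = r.
Hypothesis fd : forall x, x != r -> d (f x) < d x.
Hypothesis edges :
  forall e, e \in tedges G -> exists2 x, x != r & e = ([set x; f x], lam x).

(** For [u != w], this names the component of the tree minus [w] containing [u], by its child of
    [w]; [None] is the component of the parent of [w]. *)
Definition branch (w u : V) : option V :=
  [pick y | [&& f y == w, y != w & fconnect f u y]].

(** The time of the edge joining [w] to the branch; the default [w] selects the edge to the
    parent. *)
Definition branch_time (w u : V) : nat := lam (odflt w (branch w u)).

Lemma branch_same w u : f u != w -> branch w u = branch w (f u).
Proof.
move=> fuw; apply: eq_pick => y /=.
case: eqP => //= fy; case: eqP => //= _; apply/idP/idP => [uy|].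
  by apply: (@fconnect_up V f) => //; apply: contraNneq fuw => ->; apply/eqP.
by apply: connect_trans; apply: connect1; apply/eqP.
Qed.

Lemma branch_child u : u != r -> branch (f u) u = Some u.
Proof.
move=> ur; have fu := fd ur.
rewrite /branch; case: pickP => [y /and3P[/eqP fy yf uy]|/(_ u)]; last first.
  by rewrite eqxx connect0 andbT; case: eqP => // uf; move: fu; rewrite -uf ltnn.
have yr : y != r by apply: contraNneq yf => yr; rewrite -fy yr fr.
have [->//|uny] := eqVneq u y.
have := fconnect_depth fr fd (@fconnect_up V f _ _ uy uny); rewrite eq_sym yf => /(_ isT).
by have := fd yr; rewrite fy; lia.
Qed.

Lemma branch_parent w : w != r -> branch w (f w) = None.
Proof.
move=> wr; rewrite /branch; case: pickP => // y /and3P[/eqP fy yw wy].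
have yr : y != r by apply: contraNneq yw => yr; rewrite -fy yr fr.
have := fd wr; have := fd yr; rewrite fy.
have [->|fwy] := eqVneq (f w) y; first by lia.
by have := fconnect_depth fr fd wy fwy; lia.
Qed.

(** Changing branch takes the edge from the old branch to [w] and, later, the edge into the new one.
    The case [u == w] serves the induction, which may pass through [w]. *)
Lemma journey_branch w u v j : v != w -> journey G u v j ->
  if u == w then branch_time w v \in [seq s.2 | s <- j] : Prop
  else branch w u = branch w v \/
       branch_time w u < branch_time w v /\ branch_time w v \in [seq s.2 | s <- j].
Proof.
move=> vw; elim: j u => [|[[a b] t] j IH] u.
  by rewrite journey_nil => /eqP->; rewrite (negbTE vw); left.
rewrite journey_cons /= => /and4P[ab /eqP<- /allP gt /IH{}IH].
have [x xr [/set2_eq ex tx]] := edges ab.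
have xf : f x != x by have := fd xr; apply: contraTneq => ->; rewrite ltnn.
have [aw|aw] := eqVneq a w.
  have bt : b != w /\ branch_time w b = t.
    rewrite /branch_time -aw tx; case: ex => -[ax bx]; rewrite ax bx ?branch_child ?branch_parent //.
    by rewrite eq_sym.
  move: IH; case: bt => [/negbTE-> <-] [/(congr1 (fun o => lam (odflt w o))) e|[_ i]].
    by rewrite inE [branch_time w v]/branch_time -e eqxx.
  by rewrite inE i orbT.
move: IH; have [bw|bw] := eqVneq b w.
  move=> i; right; rewrite inE i orbT; split=> //.
  suff -> : branch_time w a = t by apply: gt.
  by rewrite /branch_time -bw tx; case: ex => -[-> ->]; rewrite ?branch_child ?branch_parent.
have -> : branch w a = branch w b.
  by case: ex aw bw => -[-> ->] aw bw; rewrite [branch w x]branch_same.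
have -> : branch_time w a = branch_time w b.
  rewrite /branch_time; congr (lam (odflt _ _)).
  by case: ex aw bw => -[-> ->] aw bw; rewrite [branch w x]branch_same.
by case=> [->|[lt i]]; [left|right; rewrite inE i orbT].
Qed.

Lemma mutual_branch A w x y : solution A G -> x != w -> mutual A w x y ->
  branch w x = branch w y.
Proof.
move=> sol xw /andP[xy yx].
have up a b : reach A w a b -> branch w a = branch w b \/ branch_time w a < branch_time w b.
  case/connectP=> p; elim: p a => [|c p IH] a /=; first by move=> _ ->; left.
  case/andP=> /and3P[aw cw /sol[j /(journey_branch cw) jb]] pc eb.
  have {}IH := IH _ pc eb; move: jb.
  rewrite (negbTE aw); case=> [e|[lt _]]; case: IH => [e'|lt'].
  - by left; rewrite e.
  - by right; rewrite /branch_time e.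
  - by right; rewrite [branch_time w b]/branch_time -e'.
  - by right; apply: ltn_trans lt'.
by case: (up _ _ xy) => // lt; case: (up _ _ yx) => // lt'; lia.
Qed.

(** If [f x] is not in [S], a shallowest [t] in [S] is in the branch of [x] at [f x]; so it is a
    descendant of [x], and deeper unless equal. *)
Lemma solution_topped A S : solution A G -> closed_walk_set A S ->
  exists t, topped r f S t.
Proof.
move=> sol cS; have [t0 t0S] := closed_walk_set_neq0 cS.
case: (@arg_minnP _ t0 (fun x => x \in S) d t0S) => t tS tmin.
exists t; apply/toppedP; split=> // x xS xt.
have xr : x != r.
  apply/eqP=> xr; have tr : t != r by rewrite -xr eq_sym.
  have := fconnect_depth fr fd (fconnect_root_all fd t) tr.
  by have := tmin x xS; rewrite xr; lia.
split=> //; apply: contraT => fx.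
have := mutual_branch sol _ (closed_walk_set_mutual cS xS tS fx).
have xf : x != f x by apply: contraNneq fx => <-.
rewrite branch_child // => /(_ xf); rewrite /branch; case: pickP => // y /and3P[_ _ ty] [e].
rewrite -e in ty; have := fconnect_depth fr fd ty; rewrite eq_sym xt => /(_ isT).
by have := tmin x xS; lia.
Qed.

End Branches.

Lemma tree_solution_helly (V : finType) (A : rel V) (G : temporal_graph V) :
  strongly_connected A -> tree_solution A G -> walk_helly A.
Proof.
move=> sc ts; have [/card_gt0P[r _] _] := sc.
have [f [d [lam [fr fd edges]]]] := tree_solution_rooted r sc ts.
apply: (topped_helly fd) => S; apply: (solution_topped fr fd edges); by case: ts.
Qed.

(** * Times on a normal tree *)

Lemma journey_cat (V : finType) (G : temporal_graph V) u w v j1 j2 :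
  journey G u w j1 -> journey G w v j2 ->
  (forall s1 s2, s1 \in j1 -> s2 \in j2 -> s1.2 < s2.2) ->
  journey G u v (j1 ++ j2).
Proof.
elim: j1 u => [|s j1 IH] u; first by rewrite journey_nil => /eqP->.
rewrite cat_cons !journey_cons => /and4P[-> -> gt /IH{}IH] /IH{}IH lt /=.
rewrite map_cat all_cat gt IH ?andbT => [|s1 s2 s1j]; last first.
  by apply: lt; rewrite inE s1j orbT.
by apply/allP=> _ /mapP[s2 s2j ->]; apply: lt => //; apply: mem_head.
Qed.

Lemma journey1 (V : finType) (G : temporal_graph V) u v t :
  ([set u; v], t) \in tedges G -> journey G u v [:: (u, v, t)].
Proof. by move=> e; rewrite journey_cons journey_nil /= e !eqxx. Qed.

(** Choose [x] with the fewest vertices reaching it: any [y] in [P] that reaches [x] then has the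
    same set of reaching vertices. *)
Lemma reach_minimal (V : finType) (A : rel V) (w : V) (P : pred V) x0 : P x0 ->
  exists2 x, P x & forall y, P y -> reach A w y x -> reach A w x y.
Proof.
move=> P0; case: (@arg_minnP _ x0 P (fun x => #|[set a | reach A w a x]|) P0) => x Px xmin.
exists x => // y Py yx.
have sub : [set a | reach A w a y] \subset [set a | reach A w a x].
  by apply/subsetP=> a; rewrite !inE => ay; apply: reach_trans yx.
have /eqP e : [set a | reach A w a y] == [set a | reach A w a x].
  by rewrite eqEcard sub xmin.
by have : x \in [set a | reach A w a x]; [rewrite inE reach_refl | rewrite -e inE].
Qed.

Section Labels.
Variables (V : finType) (A : rel V) (r : V) (f : V -> V).
Hypothesis nf : normal A r f.

Local Notation sub := (subtree A f).

(** A vertex [x] stands for the edge from [x] to [f x]. Edges sharing an endpoint [w] are compared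
    by reachability in [R - w] between their other endpoints; [w] is the common parent, [y] or [x]
    in the three cases. *)
Definition before (x y : V) : bool :=
  [&& x != r, y != r, x != y &
    [|| (f x == f y) && reach A (f x) x y,
        (f x == y) && reach A y x (f y) |
        (f y == x) && reach A x (f x) y]].

(** Otherwise [y] would lie in [sub x], and by normality so would its parent [f x]. *)
Lemma siblings_apart x y : x != r -> y != x -> f x = f y -> ~~ mutual A (f x) y x.
Proof.
move=> xr yx e; apply/negP=> m; have yS : y \in sub x by rewrite inE.
have [_] := sub_above nf xr yS yx.
by rewrite -e (negbTE (parent_notin nf xr)).
Qed.

Lemma child_in y : y != r -> f y != r -> y \in sub (f y).
Proof. by move=> yr xr; apply: (subsetP (sub_parent nf yr xr)); apply: mem_subtree. Qed.

(** With [siblings_apart], this makes the order of the edges at [f y] antisymmetric; it is the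
    [~~ mutual] clause of [normal] at [f y]. *)
Lemma child_parent_apart y : y != r -> f y != r -> ~~ mutual A (f y) y (f (f y)).
Proof.
move=> yr xr; have yx : y != f y by rewrite eq_sym; apply: normal_neq nf _ yr.
by have [] := sub_above nf xr (child_in yr xr) yx.
Qed.

(* Walk down from a topmost edge of [X], always to an edge that is minimal at its
   upper endpoint; the walk stops at an edge minimal at both endpoints. *)
Lemma before_source (X : {set V}) : X != set0 -> r \notin X ->
  exists2 x, x \in X & forall y, y \in X -> ~~ before y x.
Proof.
case/set0Pn=> x0 x0X rX.
have Xr x : x \in X -> x != r by apply: contraTneq => ->.
(* Within [X], the edge of [x] is minimal at its upper endpoint: only children of [x] can precede
   it. *)
pose low x := (x \in X) && [forall y in X, before y x ==> (f y == x)].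
have lowI x : x \in X -> (f x \in X -> ~~ reach A (f x) (f (f x)) x) ->
    (forall y, y \in X -> y != x -> f y = f x -> ~~ reach A (f x) y x) -> low x.
  move=> xX par sib; rewrite /low xX; apply/forallP=> y; apply/implyP=> yX.
  apply/implyP=> /and4P[_ _ yx /or3P[]/andP[/eqP e]].
  - by rewrite e (negbTE (sib y yX yx e)).
  - by rewrite e eqxx.
  - by rewrite -e in yX *; rewrite (negbTE (par yX)).
have [x1 low1] : exists x, low x.
  case: (@arg_minnP _ x0 (fun x => x \in X) (depth A r f) x0X) => x1 x1X x1min.
  have fx1 : f x1 \notin X.
    by apply/negP=> /x1min; rewrite leqNgt (depth_lt nf) // Xr.
  have [|x /andP[xX /eqP fx] xmin] :=
    @reach_minimal V A (f x1) (fun x => (x \in X) && (f x == f x1)) x1.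
    by rewrite x1X eqxx.
  exists x; apply: lowI => // [|y yX yx fy]; first by rewrite fx (negbTE fx1).
  apply/negP; rewrite fx => ryx.
  have rxy := xmin y _ ryx; rewrite yX fy fx eqxx in rxy.
  by have := siblings_apart (Xr x xX) yx (esym fy); rewrite fx /mutual ryx rxy.
(* A deepest low edge is a source: a predecessor would be a child of [x] reaching [f x] in [R - x],
   and a minimal such child would be low and deeper. *)
case: (@arg_maxnP _ x1 low (depth A r f) low1) => x /andP[xX /forallP lowx] xmax.
exists x => // z zX; apply/negP=> zx.
have := lowx z; rewrite zX zx /= => /eqP fz.
have rz : reach A x z (f x).
  case/and4P: zx => _ _ zx /or3P[]/andP[/eqP e] //.
    by case/eqP: (normal_neq nf (Xr x xX)); rewrite -e.
  by move=> _; have := depth_lt nf (Xr x xX); rewrite e ltnNge -fz ltnW // depth_lt // Xr.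
have [|y /and3P[yX /eqP fy ry] ymin] :=
  @reach_minimal V A x (fun y => [&& y \in X, f y == x & reach A x y (f x)]) z.
  by rewrite zX fz eqxx.
have lowy : low y.
  apply: lowI => // [_|y' y'X y'y fy'].
    have := child_parent_apart (Xr y yX); rewrite fy (Xr x xX) => /(_ isT).
    by rewrite /mutual ry.
  apply/negP; rewrite fy => r'; have ry' : reach A x y' (f x) by apply: reach_trans ry.
  have := ymin y' _ r'; rewrite y'X fy' fy eqxx ry' => /(_ isT) r''.
  by have := siblings_apart (Xr y yX) y'y (esym fy'); rewrite fy /mutual r' r''.
have /= le := xmax y lowy.
by have := depth_lt nf (Xr y yX); rewrite fy ltnNge le.
Qed.

(** Topological numbering: the value 0 means that the edge has no time yet. *)
Definition label_ready (lam : V -> nat) (x : V) : bool :=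
  [&& x != r, lam x == 0 & [forall y, (y != r) && (lam y == 0) ==> ~~ before y x]].

Definition set_label (lam : V -> nat) (c : nat) (x : V) : {ffun V -> nat} :=
  [ffun y => if y == x then c else lam y].

Definition label_step (s : {ffun V -> nat} * nat) (x : V) :=
  if label_ready s.1 x then (set_label s.1 s.2.+1 x, s.2.+1) else s.

Definition label_done (s : {ffun V -> nat} * nat) : {set V} :=
  [set x | (x == r) || (s.1 x != 0)].

Definition label_inv (s : {ffun V -> nat} * nat) : Prop :=
  (forall x, s.1 x <= s.2) /\
  forall x y, s.1 y != 0 -> before x y -> s.1 x != 0 /\ s.1 x < s.1 y.

Definition label_sweeps : {ffun V -> nat} * nat :=
  iter #|V| (sweep label_step) ([ffun=> 0], 0).

Lemma label_step_inv s x : label_inv s -> label_inv (label_step s x).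
Proof.
case: s => lam c [/= le lt]; rewrite /label_step /=; case: ifP => // /and3P[xr x0 /forallP rdy].
split=> [y|y z] /=; rewrite !ffunE; first by case: eqP => // _; apply: leqW.
case: (eqVneq z x) => [->|zx] z0 yz.
  have yx : y != x by case/and4P: yz.
  rewrite (negbTE yx) ltnS le; split=> //.
  by have := rdy y; rewrite yz implybF; case/and4P: yz => -> _ _ _.
have [y0 yz'] := lt y z z0 yz; case: (eqVneq y x) => // yx.
by rewrite yx (eqP x0) in y0.
Qed.

Lemma label_step_done s x :
  label_step s x = s \/ label_done s \proper label_done (label_step s x).
Proof.
case: s => lam c; rewrite /label_step; case: ifP => [/and3P[/= xr x0 _]|_]; [right|by left].
apply/properP; split.
  by apply/subsetP=> y; rewrite !inE /= ffunE; case: (eqVneq y x) => //= _; rewrite orbT.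
by exists x; rewrite !inE /= ?ffunE ?eqxx ?orbT // (negbTE xr) x0.
Qed.

Lemma label_progress s : label_inv s -> label_done s != setT ->
  exists x, label_done (label_step s x) != label_done s.
Proof.
case: s => lam c _ dT; have [||x] := @before_source (~: label_done (lam, c)).
- by apply: contra dT => /eqP e; rewrite -[label_done _]setCK e setC0.
- by rewrite !inE eqxx.
rewrite !inE negb_or => /andP[xr x0] src; exists x; rewrite /label_step ifT.
  apply/eqP=> /setP/(_ x); rewrite !inE /= ffunE eqxx orbT.
  by rewrite (negbTE xr) /= (negbTE x0).
rewrite negbK /= in x0; apply/and3P; split=> //.
apply/forallP=> y; apply/implyP=> /andP[yr y0]; apply: src.
by rewrite !inE (negbTE yr) negbK.
Qed.

Lemma label_sweepsP :
  (forall x, x != r -> 0 < label_sweeps.1 x) /\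
  (forall x y, before x y -> label_sweeps.1 x < label_sweeps.1 y).
Proof.
have [|[_ lt] dT] := @sweeps_done _ _ label_step label_inv label_done
  label_step_inv label_step_done label_progress ([ffun=> 0], 0).
  by split=> [x|x y]; rewrite ffunE.
have pos x : x != r -> 0 < label_sweeps.1 x.
  move=> xr; have : x \in label_done label_sweeps by rewrite dT inE.
  by rewrite inE (negbTE xr) lt0n.
split=> // x y xy; have /and4P[_ yr _ _] := xy.
by have [] := lt x y _ xy; rewrite ?lt0n // -lt0n pos.
Qed.

(** * Journeys for all requests *)

Section Solution.
Variable lam : V -> nat.
Hypothesis sc : forall u v : V, connect A u v.
Hypothesis lam_lt : forall x y, before x y -> lam x < lam y.
Variable G : temporal_graph V.
Hypothesis GE : forall x, x != r -> ([set x; f x], lam x) \in tedges G.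

(** The root needs its own case: since [f r = r], the set [sub r] is only [{r}]. *)
Definition below (w z : V) : bool := (w == r) || (z \in sub w).

Lemma child_above w u : below w u -> u != w ->
  exists y, [/\ y != r, f y = w & u \in sub y].
Proof.
move=> wu uw.
suff : forall m z, depth A r f z < m -> u \in sub z -> below w z -> z != w ->
    exists y, [/\ y != r, f y = w & u \in sub y].
  by move/(_ _ u (ltnSn _)); apply=> //; apply: mem_subtree.
elim=> // m IH z zm uz wz zw.
have [zr fzr] : z != r /\ (f z != w -> f z != r /\ below w (f z)).
  have [wr|wr] := eqVneq w r; first by rewrite wr in zw *; split=> //; rewrite /below eqxx.
  move: wz; rewrite {1}/below (negbTE wr) /= => zS.
  have [zr fz _] := sub_above nf wr zS zw; split=> // _.
  by rewrite /below fz orbT; split=> //; apply: contraTneq fz => ->; apply: root_notin nf _ wr.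
have [e|fzw] := eqVneq (f z) w; first by exists z.
have [fr' bf] := fzr fzw.
apply: (IH (f z)) => //; first exact: leq_trans (depth_lt nf zr) zm.
by apply: (subsetP (sub_parent nf zr fr')).
Qed.

(** Climb to [x] within the child subtree [sub y] containing [u], then take the edge of [x]. The
    times increase because [y] reaches [f x] in [R - x] by way of the arc from [u] to [v]. *)
Lemma journey_up x u v : x != r -> A u v -> u \in sub x -> v \notin sub x ->
  exists2 j, journey G u (f x) j & forall s, s \in j -> s.2 <= lam x.
Proof.
have [m] := ubnP #|sub x|; elim: m x => // m IH x xm xr uv ux vx.
have fx := normal_neq nf xr.
have [->|uxn] := eqVneq u x.
  exists [:: (x, f x, lam x)]; first exact/journey1/GE.
  by move=> s; rewrite inE => /eqP->.
have [|y [yr fy uy]] := @child_above x u _ uxn; first by rewrite /below ux orbT.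
have xy : x \notin sub y by rewrite -fy; apply: parent_notin nf _ yr.
have yx : sub y \subset sub x by rewrite -fy; apply: sub_parent nf _ yr _; rewrite fy.
have ltm : #|sub y| < m.
  suff lt : #|sub y| < #|sub x| by apply: leq_trans lt xm.
  by apply: proper_card; apply/properP; split=> //; exists x => //; apply: mem_subtree.
have [j ju jle] := IH y ltm yr uv uy (contra (subsetP yx v) vx).
rewrite fy in ju.
have vnx : v != x by apply: contraNneq vx => ->; apply: mem_subtree.
have lt : lam y < lam x.
  apply: lam_lt; rewrite /before yr xr /=; apply/andP; split.
    by apply: contraNneq xy => ->; apply: mem_subtree.
  rewrite fy eqxx /=; apply/orP; right; apply/orP; left.
  have yu : reach A x y u by move: uy; rewrite inE fy => /andP[].
  apply: reach_trans yu _; apply: reach_trans (reach_arc uxn vnx uv) _.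
  (* If [v] reached [x] without [f x], it would lie in [sub x]. *)
  have [| |vr|//] := @connect_avoid _ A x (f x) v; rewrite ?sc // 1?eq_sym //.
  case/negP: vx; rewrite inE /mutual vr /=.
  have := ux; rewrite inE => /andP[u1 u2].
  have xf : x != f x by rewrite eq_sym.
  by apply: reach_trans u2 _; apply: reach_arc uv; [apply: reach_neqV u1 xf|apply: reach_neqV vr xf].
exists (j ++ [:: (x, f x, lam x)]).
  apply: journey_cat ju _ _; first exact/journey1/GE.
  by move=> s1 s2 /jle le; rewrite inE => /eqP->; apply: leq_ltn_trans le lt.
move=> s; rewrite mem_cat => /orP[/jle le|]; last by rewrite inE => /eqP->.
exact: leq_trans le (ltnW lt).
Qed.

(** Mirror image of [journey_up]. *)
Lemma journey_down y u v : y != r -> A u v -> v \in sub y -> u \notin sub y ->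
  exists2 j, journey G (f y) v j & forall s, s \in j -> lam y <= s.2.
Proof.
have [m] := ubnP #|sub y|; elim: m y => // m IH y ym yr uv vy uy.
have fy := normal_neq nf yr.
have yE : ([set f y; y], lam y) \in tedges G by rewrite setUC GE.
have [->|vyn] := eqVneq v y.
  exists [:: (f y, y, lam y)]; first exact/journey1.
  by move=> s; rewrite inE => /eqP->.
have [|z [zr fz vz]] := @child_above y v _ vyn; first by rewrite /below vy orbT.
have yz : y \notin sub z by rewrite -fz; apply: parent_notin nf _ zr.
have zy : sub z \subset sub y by rewrite -fz; apply: sub_parent nf _ zr _; rewrite fz.
have ltm : #|sub z| < m.
  suff lt : #|sub z| < #|sub y| by apply: leq_trans lt ym.
  by apply: proper_card; apply/properP; split=> //; exists y => //; apply: mem_subtree.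
have [j ju jle] := IH z ltm zr uv vz (contra (subsetP zy u) uy).
rewrite fz in ju.
have uny : u != y by apply: contraNneq uy => ->; apply: mem_subtree.
have lt : lam y < lam z.
  apply: lam_lt; rewrite /before yr zr /=; apply/andP; split.
    by apply: contraNneq yz => ->; apply: mem_subtree.
  rewrite fz eqxx /=; apply/orP; right; apply/orP; right.
  have vz' : reach A y v z by move: vz; rewrite inE fz => /andP[].
  apply: reach_trans vz'; apply: reach_trans (reach_arc uny vyn uv).
  have [| |ur|//] := @avoid_connect _ A y (f y) u; rewrite ?sc // 1?eq_sym //.
  case/negP: uy; rewrite inE /mutual ur andbT.
  have := vy; rewrite inE => /andP[v1 v2].
  have yf : y != f y by rewrite eq_sym.
  by apply: reach_trans (v1); apply: reach_arc uv; [apply: reach_neq ur yf|apply: reach_neqV v1 yf].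
exists ((f y, y, lam y) :: j).
  rewrite -cat1s; apply: journey_cat ju _; first exact/journey1.
  by move=> s1 s2; rewrite inE => /eqP-> /jle le; apply: leq_trans lt le.
move=> s; rewrite inE => /orP[/eqP->//|/jle le].
exact: leq_trans (ltnW lt) le.
Qed.

(** Let [w] be a deepest vertex with both ends below it: climb from [u] to [w], then descend to [v].
    If neither end is [w], the arc itself orders the two edges used at [w]. *)
Lemma normal_solution : solution A G.
Proof.
move=> u v uv.
have [->|nuv] := eqVneq u v; first by exists [::]; rewrite journey_nil.
have P0 : below r u && below r v by rewrite /below eqxx.
case: (@arg_maxnP _ r (fun w => below w u && below w v) (depth A r f) P0) => w /andP[wu wv] wmax.
have deeper x : x != r -> f x = w -> u \in sub x -> v \in sub x -> false.
  move=> xr fx ux vx; have := wmax x; rewrite /below ux vx !orbT => /(_ isT).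
  by rewrite /= leqNgt -fx (depth_lt nf xr).
have [uw|uw] := eqVneq u w.
  have [|y [yr fy vy]] := child_above wv; first by rewrite -uw eq_sym.
  have [|j jv _] := journey_down yr uv vy; first by rewrite uw -fy; apply: parent_notin nf _ yr.
  by exists j; rewrite uw -fy.
have [vw|vw] := eqVneq v w.
  have [x [xr fx ux]] := child_above wu uw.
  have [|j jv _] := journey_up xr uv ux; first by rewrite vw -fx; apply: parent_notin nf _ xr.
  by exists j; rewrite vw -fx.
have [x [xr fx ux]] := child_above wu uw.
have [y [yr fy vy]] := child_above wv vw.
have vx : v \notin sub x by apply/negP=> vx; have := deeper x xr fx ux vx.
have uy : u \notin sub y by apply/negP=> uy; have := deeper y yr fy uy vy.
have [j1 ju le1] := journey_up xr uv ux vx.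
have [j2 jv le2] := journey_down yr uv vy uy.
have lt : lam x < lam y.
  apply: lam_lt; rewrite /before xr yr /=; apply/andP; split.
    by apply: contraNneq vx => ->.
  rewrite fx fy eqxx; apply/orP; left; rewrite /=.
  move: ux vy; rewrite !inE fx fy => /andP[_ xu] /andP[vy _].
  by apply: reach_trans xu _; apply: reach_trans vy; apply: reach_arc.
exists (j1 ++ j2); rewrite fx in ju; rewrite fy in jv; apply: journey_cat ju jv _.
by move=> s1 s2 /le1 l1 /le2 l2; apply: leq_ltn_trans l1 (leq_trans lt l2).
Qed.

End Solution.
End Labels.

Lemma parent_graph (V : finType) (r : V) (f : V -> V) (d lam : V -> nat) :
  f r = r -> (forall x, x != r -> d (f x) < d x) -> (forall x, x != r -> 0 < lam x) ->
  exists G : temporal_graph V,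
    perm_eq (tedges G) [seq ([set x; f x], lam x) | x <- enum (predC1 r)].
Proof.
move=> fr fd pos; set L := map _ _.
have uL : uniq L.
  rewrite map_inj_in_uniq ?enum_uniq // => x y.
  rewrite !mem_enum !inE => xr yr [/set2_eq[[]//|[xy yx]] _].
  by have := fd x xr; have := fd y yr; rewrite -xy yx; lia.
have ok e : e \in [fset e in L]%fset -> #|e.1| = 2 /\ 0 < e.2.
  rewrite !inE => /mapP[x]; rewrite mem_enum => xr -> /=.
  rewrite cards2 pos //; split=> //; case: eqP => // xf.
  by have := fd x xr; rewrite -xf ltnn.
exists (TemporalGraph ok); apply: uniq_perm => //.
by move=> e; rewrite !inE.
Qed.

Lemma normal_tree_solution (V : finType) (A : rel V) (r : V) (f : V -> V)
    (G : temporal_graph V) (lam : V -> nat) :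
  strongly_connected A -> normal A r f ->
  (forall x y, before A r f x y -> lam x < lam y) ->
  perm_eq (tedges G) [seq ([set x; f x], lam x) | x <- enum (predC1 r)] ->
  tree_solution A G.
Proof.
move=> [_ sc] nf lt pG; split.
  apply: (normal_solution nf sc lt) => x xr.
  by rewrite (perm_mem pG); apply/mapP; exists x; rewrite ?mem_enum.
by rewrite (perm_size pG) size_map -cardE cardC1.
Qed.

(** * Structured programs with polynomial running time *)

Definition var (x : nat) : expr := Cell x (Const 0) (Const 0).

(** The only loop runs as often as cell [0[0, 0]] says, so [run] is a total function and polynomial
    time follows by structural induction. *)
Inductive prog :=
  | Asg of nat & expr & expr & expr
  | Then of prog & prog
  | Test of expr & prog & prog
  | Nop
  | For of nat & prog.

Fixpoint compile (p : prog) : cmd :=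
  match p with
  | Asg x i j e => Assign x i j e
  | Then p q => Seq (compile p) (compile q)
  | Test e p q => If e (compile p) (compile q)
  | Nop => Skip
  | For v p =>
      Seq (Assign v (Const 0) (Const 0) (Const 0))
        (While (Sub (var 0) (var v))
          (Seq (compile p) (Assign v (Const 0) (Const 0) (Add (var v) (Const 1)))))
  end.

Definition incr_var (v : nat) (s : store) : store := update s v 0 0 (s v 0 0 + 1).

Fixpoint run (p : prog) (s : store) : store :=
  match p with
  | Asg x i j e => update s x (eval s i) (eval s j) (eval s e)
  | Then p q => run q (run p s)
  | Test e p q => if eval s e != 0 then run p s else run q s
  | Nop => s
  | For v p => iter (s 0 0 0) (fun s => incr_var v (run p s)) (update s v 0 0 0)
  end.

Fixpoint writes (p : prog) : seq nat :=
  match p with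
  | Asg x _ _ _ => [:: x]
  | Then p q | Test _ p q => writes p ++ writes q
  | Nop => [::]
  | For v p => v :: writes p
  end.

(** Array 0 is never written, so all loops keep the bound [n], and no loop body touches its own
    counter. *)
Fixpoint wf (p : prog) : bool :=
  match p with
  | Asg x _ _ _ => x != 0
  | Then p q | Test _ p q => wf p && wf q
  | Nop => true
  | For v p => [&& v != 0, v \notin writes p & wf p]
  end.

Lemma update_other s x i j m y k l : y != x -> update s x i j m y k l = s y k l.
Proof. by rewrite /update => /negbTE->. Qed.

Lemma run_frame p s x i j : x \notin writes p -> run p s x i j = s x i j.
Proof.
elim: p s => [y e1 e2 e|p IHp q IHq|e p IHp q IHq||v p IH] s //=.
- by rewrite inE => xy; rewrite update_other.
- by rewrite mem_cat negb_or => /andP[xp xq]; rewrite IHq ?IHp.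
- by rewrite mem_cat negb_or => /andP[xp xq]; case: ifP => _; [apply: IHp|apply: IHq].
rewrite inE negb_or => /andP[xv xp].
by elim: (s 0 0 0) => [|n IHn] /=; rewrite /incr_var ?update_other // IH.
Qed.

Lemma wf_writes p : wf p -> 0 \notin writes p.
Proof.
elim: p => [y e1 e2 e|p IHp q IHq|e p IHp q IHq||v p IH] //=.
- by rewrite inE eq_sym.
- by case/andP=> /IHp hp /IHq hq; rewrite mem_cat negb_or hp.
- by case/andP=> /IHp hp /IHq hq; rewrite mem_cat negb_or hp.
by case/and3P=> v0 _ /IH hp; rewrite inE negb_or eq_sym v0.
Qed.

Lemma leq_pow_succ c1 d1 c2 d2 n :
  c1 * n.+1 ^ d1 + c2 * n.+1 ^ d2 <= (c1 + c2) * n.+1 ^ (d1 + d2).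
Proof.
by rewrite mulnDl leq_add // leq_mul2l leq_pexp2l ?leq_addr ?leq_addl ?orbT.
Qed.

(** Powers of [n + 1] are at least 1, so bounds of different degrees merge. *)
Lemma compile_exec p : wf p -> exists c d, forall s, exists t,
  t <= c * (s 0 0 0).+1 ^ d /\ exec (compile p) s t (run p s).
Proof.
elim: p => [x i j e|p IHp q IHq|e p IHp q IHq||v p IH] /=.
- move=> _; exists (cost i + cost j + cost e).+1, 0 => s.
  by exists (cost i + cost j + cost e).+1; rewrite expn0 muln1; split=> //; apply: ExecAssign.
- case/andP=> wp /IHq[c2 [d2 hq]]; have [c1 [d1 hp]] := IHp wp.
  exists (c1 + c2), (d1 + d2) => s.
  have [t1 [le1 e1]] := hp s; have [t2 [le2 e2]] := hq (run p s).
  exists (t1 + t2); split; last exact: ExecSeq e1 e2.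
  move: le2; rewrite run_frame ?wf_writes // => le2.
  by apply: leq_trans (leq_pow_succ _ _ _ _ _); apply: leq_add.
- case/andP=> /IHp[c1 [d1 hp]] /IHq[c2 [d2 hq]].
  exists ((cost e).+1 + (c1 + c2)), (0 + (d1 + d2)) => s.
  have [t1 [le1 e1]] := hp s; have [t2 [le2 e2]] := hq s.
  have := leq_pow_succ c1 d1 c2 d2 (s 0 0 0).
  have := leq_pow_succ (cost e).+1 0 (c1 + c2) (d1 + d2) (s 0 0 0); rewrite expn0.
  case: ifP => [E|/negbFE/eqP E] l1 l2.
    by exists (cost e + t1).+1; split; [lia|apply: ExecIfTrue].
  by exists (cost e + t2).+1; split; [lia|apply: ExecIfFalse].
- by move=> _; exists 1, 0 => s; exists 1; split=> //; apply: ExecSkip.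
case/and3P=> v0 vp wp; have [c [d hp]] := IH wp.
exists (c + 16), d.+1 => s; set n := s 0 0 0; set body := fun s => incr_var v (run p s).
(* An iteration costs 16 besides the body: 8 for the successful test, 8 for the increment. The
   failing test at the end costs 8. *)
pose K := c * n.+1 ^ d + 16.
have loop k s' : s' 0 0 0 = n -> s' v 0 0 + k = n -> exists t, t <= k * K + 8 /\
    exec (While (Sub (var 0) (var v))
          (Seq (compile p) (Assign v (Const 0) (Const 0) (Add (var v) (Const 1)))))
      s' t (iter k body s').
  elim: k s' => [|k IHk] s' s0 sv.
    by exists 8; split=> //; apply: ExecWhileFalse; rewrite /= s0 -sv addn0 subnn.
  have [t1 [le1 e1]] := hp s'; rewrite s0 in le1.
  have [||t2 [le2 e2]] := IHk (body s').
  - by rewrite /body /incr_var update_other 1?eq_sym // run_frame ?wf_writes.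
  - by rewrite /body /incr_var /update !eqxx /= run_frame //; lia.
  exists (7 + (t1 + 8) + t2).+1; split; first by rewrite /K; lia.
  rewrite iterSr; apply: ExecWhileTrue e2; first by rewrite /= s0; lia.
  by apply: ExecSeq e1 _; apply: ExecAssign.
have [||t [le e]] := loop n (update s v 0 0 0).
- by rewrite update_other // eq_sym.
- by rewrite /update !eqxx.
exists (4 + t); split; last by apply: ExecSeq e; apply: ExecAssign.
have : 1 <= n.+1 ^ d by rewrite expn_gt0.
by rewrite expnS; move: le; rewrite /K; nia.
Qed.

(** [(n + 1) ^ d] is at most [2 ^ d * n ^ d] for positive [n]; the additive constant covers
    [n = 0]. *)
Lemma compile_poly p : wf p -> exists c d, forall s, exists t,
  t <= c * s 0 0 0 ^ d + c /\ exec (compile p) s t (run p s).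
Proof.
case/compile_exec=> c [d h]; exists (c * 2 ^ d), d => s; have [t [le e]] := h s.
exists t; split=> //; apply: leq_trans le _; rewrite -mulnA -mulnDr leq_mul2l.
apply/orP; right; case: (s 0 0 0) => [|n].
  by rewrite exp1n; apply: leq_trans (leq_addl _ _); rewrite expn_gt0.
apply: leq_trans (leq_addr _ _); rewrite -expnMn.
by case: d {h} => [|d] //; rewrite leq_exp2r; lia.
Qed.

(** Invariant rule for loops. [I] must ignore the counter, which is set outside the body; the body
    may assume that unwritten arrays keep their initial contents. *)
Lemma run_For (I : nat -> store -> Prop) v p s : wf (For v p) ->
  (forall k s' m, I k s' -> I k (update s' v 0 0 m)) ->
  I 0 s ->
  (forall k s', k < s 0 0 0 -> s' v 0 0 = k ->
     (forall x i j, x \notin v :: writes p -> s' x i j = s x i j) ->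
     I k s' -> I k.+1 (run p s')) ->
  I (s 0 0 0) (run (For v p) s).
Proof.
move=> /= /and3P[v0 vp wp] stab I0 step.
suff : forall k, k <= s 0 0 0 ->
  let s' := iter k (fun s => incr_var v (run p s)) (update s v 0 0 0) in
  [/\ I k s', s' v 0 0 = k & forall x i j, x \notin v :: writes p -> s' x i j = s x i j].
  by move/(_ _ (leqnn _)) => [].
elim=> [|k IH] le /=.
  split; [exact: stab|by rewrite /update !eqxx|].
  by move=> x i j; rewrite inE negb_or => /andP[xv _]; rewrite update_other.
have [Ik vk fr] := IH (ltnW le); split.
- by apply/stab/step.
- by rewrite /incr_var /update !eqxx run_frame // vk addn1.
move=> x i j xw; rewrite /incr_var update_other; last by apply: contraNneq xw => ->; apply: mem_head.
by rewrite run_frame ?fr //; apply: contra xw; rewrite inE orbC => ->.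
Qed.

(** * The program *)

Definition truth (s : store) (e : expr) : bool := eval s e != 0.
Definition notE (e : expr) : expr := Sub (Const 1) e.
Definition orE : expr -> expr -> expr := Add.
Definition andE (e1 e2 : expr) : expr := notE (Add (notE e1) (notE e2)).
Definition neqE (e1 e2 : expr) : expr := Add (Sub e1 e2) (Sub e2 e1).
Definition equalE (e1 e2 : expr) : expr := notE (neqE e1 e2).

Lemma truth_not s e : truth s (notE e) = ~~ truth s e.
Proof. by rewrite /truth /=; lia. Qed.
Lemma truth_or s e1 e2 : truth s (orE e1 e2) = truth s e1 || truth s e2.
Proof. by rewrite /truth /=; lia. Qed.
Lemma truth_and s e1 e2 : truth s (andE e1 e2) = truth s e1 && truth s e2.
Proof. by rewrite /truth /=; lia. Qed.
Lemma truth_neq s e1 e2 : truth s (neqE e1 e2) = (eval s e1 != eval s e2).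
Proof. by rewrite /truth /=; lia. Qed.
Lemma truth_equal s e1 e2 : truth s (equalE e1 e2) = (eval s e1 == eval s e2).
Proof. by rewrite truth_not truth_neq negbK. Qed.
Definition truthE := (truth_and, truth_equal, truth_neq, truth_or, truth_not).

Definition When (e : expr) (p : prog) : prog := Test e p Nop.

Lemma run_When e p s : run (When e p) s = if truth s e then run p s else s.
Proof. by []. Qed.

Lemma run_Then p q s : run (Then p q) s = run q (run p s).
Proof. by []. Qed.

Definition arr (x : nat) (i : expr) : expr := Cell x i (Const 0).
Definition set_var (x : nat) (e : expr) : prog := Asg x (Const 0) (Const 0) e.

(* Memory layout: arrays 6, 7 and 8 hold the parents, the settled vertices and the
   times (0 while there is none); cells 10 to 14 are loop counters, 20 is a flag,
   21 the parent of the current vertex and 22 the last time given out. *)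

(* Arrays have two indices only: row [w * n + a] of array 4 holds the vertices
   reachable from [a] in the digraph without [w], and [w * n] is looked up in array 5. *)
Definition row (w a : expr) : expr := Add (arr 5 w) a.
Definition reachE (w a b : expr) : expr := Cell 4 (row w a) b.
Definition mutualE (w a b : expr) : expr := andE (reachE w a b) (reachE w b a).

Definition base_prog : prog :=
  For 10 (Asg 5 (Add (var 10) (Const 1)) (Const 0) (Add (arr 5 (var 10)) (var 0))).

Definition refl_prog : prog :=
  For 10 (For 11 (Asg 4 (row (var 10) (var 11)) (var 11) (Const 1))).

(** One Bellman-Ford round for all [R - w] at once; counter 11 is left to the loop repeating it. *)
Definition extend_prog : prog :=
  For 10 (For 12 (For 13 (For 14
    (When (andE (reachE (var 10) (var 12) (var 13))
            (andE (neqE (var 13) (var 10))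
              (andE (neqE (var 14) (var 10)) (Cell 1 (var 13) (var 14)))))
       (Asg 4 (row (var 10) (var 12)) (var 14) (Const 1)))))).

Definition check_prog : prog :=
  For 12 (When (andE (neqE (var 12) (var 11))
            (andE (mutualE (var 21) (var 12) (var 11)) (mutualE (var 11) (var 12) (var 21))))
       (set_var 20 (Const 0))).

Definition settle_prog : prog :=
  For 12 (When (andE (neqE (var 12) (var 11)) (mutualE (var 21) (var 12) (var 11)))
       (Asg 6 (var 12) (Const 0) (var 11))).

Definition tree_step_prog : prog :=
  When (notE (arr 7 (var 11)))
    (Then (set_var 20 (Const 1)) (Then (set_var 21 (arr 6 (var 11))) (Then check_prog
      (When (var 20) (Then (Asg 7 (var 11) (Const 0) (Const 1)) settle_prog))))).

(** The root is vertex 0, so [x] and [y] themselves serve as the tests against the root. *)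
Definition beforeE (x y : expr) : expr :=
  andE x (andE y (andE (neqE x y)
    (orE (andE (equalE (arr 6 x) (arr 6 y)) (reachE (arr 6 x) x y))
    (orE (andE (equalE (arr 6 x) y) (reachE y x (arr 6 y)))
         (andE (equalE (arr 6 y) x) (reachE x (arr 6 x) y)))))).

Definition label_check_prog : prog :=
  For 12 (When (andE (andE (var 12) (notE (arr 8 (var 12)))) (beforeE (var 12) (var 11)))
       (set_var 20 (Const 0))).

Definition label_step_prog : prog :=
  When (andE (var 11) (notE (arr 8 (var 11))))
    (Then (set_var 20 (Const 1)) (Then label_check_prog
      (When (var 20) (Then (set_var 22 (Add (var 22) (Const 1)))
        (Asg 8 (var 11) (Const 0) (var 22)))))).

(** Row [k] is the edge of vertex [k + 1]. The loop writes one row too many, which the count in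
    array 2 cuts off. *)
Definition output_prog : prog :=
  Then (For 10 (Then (Asg 3 (var 10) (Const 0) (Add (var 10) (Const 1)))
         (Then (Asg 3 (var 10) (Const 1) (arr 6 (Add (var 10) (Const 1))))
               (Asg 3 (var 10) (Const 2) (arr 8 (Add (var 10) (Const 1)))))))
    (set_var 2 (Sub (var 0) (Const 1))).

Definition tree_solution_prog : prog :=
  Then base_prog (Then refl_prog (Then (For 11 extend_prog)
  (Then (Asg 7 (Const 0) (Const 0) (Const 1)) (Then (For 10 (For 11 tree_step_prog))
  (Then (For 10 (For 11 label_step_prog)) output_prog))))).

Lemma wf_tree_solution_prog : wf tree_solution_prog.
Proof. by []. Qed.

(** * Computing reachability in all digraphs [R - w] *)

Section Correctness.
Variables (n : nat) (A : rel 'I_n.+1).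
Local Notation N := n.+1.
Local Notation V := 'I_n.+1.
Implicit Types (s : store) (w a b : V).

Definition reached s w a b : bool := s 4 (w * N + a) b != 0.

Definition dims s : Prop := s 0 0 0 = N /\ forall w, s 5 w 0 = w * N.

Lemma dims_eq s s' : (forall i j, s' 0 i j = s 0 i j) -> (forall i j, s' 5 i j = s 5 i j) ->
  dims s -> dims s'.
Proof. by move=> e0 e5 [s0 s5]; split=> [|w]; rewrite ?e0 ?e5. Qed.

Lemma base_run s : s 0 0 0 = N -> s 5 0 0 = 0 -> dims (run base_prog s).
Proof.
move=> s0 s5; have [] : let s' := run base_prog s in
    (forall i, i <= s 0 0 0 -> s' 5 i 0 = i * N) /\ s' 0 0 0 = N.
  split; last by rewrite run_frame.
  apply: (@run_For (fun m s' => forall i, i <= m -> s' 5 i 0 = i * N)) => //.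
    by case.
  move=> m s' mN vm fr h i im /=; rewrite /update /= vm addn1 (fr 0) // s0 andbT.
  case: eqP => [->|ne]; first by rewrite h // mulSn addnC.
  by apply: h; lia.
by move=> h s0'; split=> // w; apply: h; rewrite s0; apply/ltnW.
Qed.

Lemma row_inj w a w' a' : (w * N + a == w' * N + a') = (w == w') && (a == a').
Proof.
apply/eqP/andP => [e|[/eqP-> /eqP->]//].
have ea : a = a'.
  by apply/val_inj; have := congr1 (modn^~ N) e; rewrite /= !modnMDl !modn_small.
split; last by rewrite ea.
by move: e; rewrite ea => /eqP; rewrite eqn_add2r eqn_pmul2r.
Qed.

Lemma eval_row s ew ea w a : dims s -> eval s ew = w -> eval s ea = a ->
  eval s (row ew ea) = w * N + a.
Proof. by move=> [_ s5] /= -> ->; rewrite s5. Qed.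

Lemma truth_reach s ew ea eb w a b :
  dims s -> eval s ew = w -> eval s ea = a -> eval s eb = b ->
  truth s (reachE ew ea eb) = reached s w a b.
Proof. by move=> [_ s5] e1 e2 e3; rewrite /truth /= e1 e2 e3 s5. Qed.

Lemma reached_set s w a b w' a' b' :
  reached (update s 4 (w * N + a) b 1) w' a' b' =
  [&& w' == w, a' == a & b' == b] || reached s w' a' b'.
Proof.
rewrite /reached /update eqxx row_inj -andbA -(val_eqE b' b) /=.
by case: ifP.
Qed.

Definition grows s s' : Prop := forall w a b, reached s w a b -> reached s' w a b.
Definition sound s : Prop := forall w a b, reached s w a b -> reach A w a b.

(* [adds P s s'] is the contract of a loop nest: it keeps the array monotone and
   sound and enters the triples [P s]. *)
Definition adds (P : store -> V -> V -> V -> Prop) s s' : Prop :=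
  [/\ grows s s', sound s -> sound s' & forall w a b, P s w a b -> reached s' w a b].

(** [mono] carries the premises of a triple from the start of the loop to the iteration that enters
    it; [grows] keeps it afterwards. *)
Lemma For_adds v p s (P : V -> store -> V -> V -> V -> Prop) :
  wf (For v p) -> v != 4 -> s 0 0 0 = N ->
  (forall (k : V) s1 s2 w a b, grows s1 s2 -> P k s1 w a b -> P k s2 w a b) ->
  (forall (k : V) s1, s1 v 0 0 = k ->
     (forall x i j, x \notin v :: writes p -> s1 x i j = s x i j) ->
     adds (P k) s1 (run p s1)) ->
  adds (fun s w a b => exists k, P k s w a b) s (run (For v p) s).
Proof.
move=> wfp v4 s0 mono step.
have : adds (fun s w a b => exists2 k : V, k < s 0 0 0 & P k s w a b) s (run (For v p) s).
  apply: (@run_For (fun m s' => adds (fun s w a b => exists2 k : V, k < m & P k s w a b) s s')) => //.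
  - move=> k s' m [g so h].
    have e w a b : reached (update s' v 0 0 m) w a b = reached s' w a b.
      by rewrite /reached update_other // eq_sym.
    by split=> [w a b|/so so' w a b|w a b]; rewrite e //; [apply: g|apply: so'|apply: h].
  - by split=> // w a b [].
  move=> m s' mN vm fr [g so h]; rewrite s0 in mN.
  have [g' so' h'] := step (Ordinal mN) s' vm fr.
  split=> [w a b /g/g'|/so/so'|w a b [k km pk]] //.
  move: km; rewrite ltnS leq_eqVlt => /orP[/eqP km|km]; last by apply/g'/h; exists k.
  by apply: h'; apply: mono g _; have <- : k = Ordinal mN by apply: val_inj.
case=> g so h; split=> // w a b [k pk]; apply: h; exists k => //.
by rewrite s0.
Qed.

Lemma refl_run s : dims s -> (forall w a b, ~~ reached s w a b) ->
  sound (run refl_prog s) /\ forall w a, reached (run refl_prog s) w a a.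
Proof.
move=> ds no.
have [_ so h] : adds (fun _ w a b => exists k1 k2 : V, [/\ w = k1, a = k2 & b = k2])
    s (run refl_prog s).
  apply: (@For_adds 10) => //; first by case: ds.
  move=> k1 s1 v1 fr1; have ds1 : dims s1 by apply: dims_eq ds => i j; apply: fr1.
  apply: (@For_adds 11) => //; first by case: ds1.
  move=> k2 s2 v2 fr2; have ds2 : dims s2 by apply: dims_eq ds1 => i j; apply: fr2.
  have e1 : eval s2 (var 10) = k1 by rewrite /= fr2.
  have e2 : eval s2 (var 11) = k2 by [].
  rewrite /run (eval_row ds2 e1 e2) e2; split=> [w a b|so w a b|w a b [-> -> ->]]; rewrite reached_set.
  - by move->; rewrite orbT.
  - by case/orP=> [/and3P[_ /eqP-> /eqP->]|/so//]; apply: reach_refl.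
  - by rewrite !eqxx.
split=> [|w a]; last by apply: h; exists w, a.
by apply: so => w a b rs; have := no w a b; rewrite rs.
Qed.

Definition arcs s : Prop := forall a b, s 1 a b = A a b.

(** A round may already use entries it made itself; this is harmless, as [adds] gives only a lower
    bound and soundness. *)
Lemma extend_run s : dims s -> arcs s ->
  adds (fun s w a b => exists2 k : V, reached s w a k & avoid A w k b) s (run extend_prog s).
Proof.
move=> ds cs.
have [g so h] : adds (fun s w a b => exists k1 k2 k3 k4 : V,
    [/\ w = k1, a = k2, b = k4, reached s k1 k2 k3 & avoid A k1 k3 k4]) s (run extend_prog s).
  apply: (@For_adds 10) => //; first by case: ds.
    by move=> k1 s1 s2 w a b g [k2 [k3 [k4 [? ? ? /g ? ?]]]]; exists k2, k3, k4.
  move=> k1 s1 v1 fr1; have ds1 : dims s1 by apply: dims_eq ds => i j; apply: fr1.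
  apply: (@For_adds 12) => //; first by case: ds1.
    by move=> k2 s2 s3 w a b g [k3 [k4 [? ? ? /g ? ?]]]; exists k3, k4.
  move=> k2 s2 v2 fr2; have ds2 : dims s2 by apply: dims_eq ds1 => i j; apply: fr2.
  apply: (@For_adds 13) => //; first by case: ds2.
    by move=> k3 s3 s4 w a b g [k4 [? ? ? /g ? ?]]; exists k4.
  move=> k3 s3 v3 fr3; have ds3 : dims s3 by apply: dims_eq ds2 => i j; apply: fr3.
  apply: (@For_adds 14) => //; first by case: ds3.
    by move=> k4 s4 s5 w a b g [? ? ? /g ? ?].
  move=> k4 s4 v4 fr4; have ds4 : dims s4 by apply: dims_eq ds3 => i j; apply: fr4.
  have e1 : eval s4 (var 10) = k1 by rewrite /= fr4 ?fr3 ?fr2.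
  have e2 : eval s4 (var 12) = k2 by rewrite /= fr4 ?fr3.
  have e3 : eval s4 (var 13) = k3 by rewrite /= fr4.
  have e4 : eval s4 (var 14) = k4 by [].
  have e5 : truth s4 (Cell 1 (var 13) (var 14)) = A k3 k4.
    rewrite /truth -[eval _ _]/(s4 1 (eval s4 (var 13)) (eval s4 (var 14))) e3 e4.
    by rewrite fr4 // fr3 // fr2 // fr1 // cs eqb0 negbK.
  rewrite run_When !truthE e5 (truth_reach ds4 e1 e2 e3) e1 e3 e4 !val_eqE.
  rewrite -[X in _ && X]/(avoid A k1 k3 k4); case: ifP => [/andP[r1 r2]|no]; last first.
    by split=> // w a b [_ _ _ r1 r2]; rewrite r1 r2 in no.
  rewrite /run (eval_row ds4 e1 e2) e4.
  split=> [w a b|so w a b|w a b [-> -> -> _ _]]; rewrite reached_set.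
  - by move->; rewrite orbT.
  - case/orP=> [/and3P[/eqP-> /eqP-> /eqP->]|/so//].
    by apply: reach_trans (so _ _ _ r1) _; apply: connect1.
  - by rewrite !eqxx.
split=> // w a b [k r1 r2]; apply: h; by exists w, a, k, b.
Qed.

(** After [m] rounds all walks with at most [m] arcs are recorded; walks shorten to paths without
    repeated vertices, so [n + 1] rounds suffice. *)
Lemma reach_run s : dims s -> arcs s -> sound s -> (forall w a, reached s w a a) ->
  forall w a b, reached (run (For 11 extend_prog) s) w a b = reach A w a b.
Proof.
move=> ds cs so re.
have [so' h] : let s' := run (For 11 extend_prog) s in sound s' /\
    forall w a p, size p <= s 0 0 0 -> path (avoid A w) a p -> reached s' w a (last a p).
  apply: (@run_For (fun m s' => sound s' /\
    forall w a p, size p <= m -> path (avoid A w) a p -> reached s' w a (last a p))) => //.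
    by split=> // w a [|//].
  move=> m s' mN vm fr [so' h].
  have ds' : dims s' by apply: dims_eq ds => i j; apply: fr.
  have cs' : arcs s' by move=> a b; rewrite fr.
  have [g so'' ext] := extend_run ds' cs'.
  split; first exact: so''.
  move=> w a p; case/lastP: p => [|p b] sp; first by move=> _; apply/g/h.
  rewrite rcons_path last_rcons => /andP[pp pb]; apply: ext; exists (last a p) => //.
  by apply: h pp; rewrite size_rcons in sp.
move=> w a b; apply/idP/idP => [/so'//|/connectP[p0 pp0 ->]].
case/shortenP: pp0 => p pp up _; apply: h pp.
have := max_card (mem (a :: p)); rewrite (card_uniqP up) card_ord /=.
by case: ds => -> _; lia.
Qed.

End Correctness.

(** * Simulation of the greedy sweeps by programs *)

Section Phases.
Variables (n : nat) (A : rel 'I_n.+1).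
Local Notation N := n.+1.
Local Notation V := 'I_n.+1.
Implicit Types (s : store) (f : V -> V).

Definition known (s : store) : Prop :=
  dims n s /\ forall w a b : V, reached s w a b = reach A w a b.

Lemma known_eq s s' :
  (forall x i j, x \in [:: 0; 4; 5] -> s' x i j = s x i j) -> known s -> known s'.
Proof.
move=> e [ds rs]; split=> [|w a b]; last by rewrite -rs /reached e.
by apply: dims_eq ds => i j; apply: e.
Qed.

Lemma truth_reach_known s ew ea eb (w a b : V) :
  known s -> eval s ew = w -> eval s ea = a -> eval s eb = b ->
  truth s (reachE ew ea eb) = reach A w a b.
Proof. by case=> ds rs e1 e2 e3; rewrite (truth_reach ds e1 e2 e3). Qed.

Lemma truth_mutual s ew ea eb (w a b : V) :
  known s -> eval s ew = w -> eval s ea = a -> eval s eb = b ->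
  truth s (mutualE ew ea eb) = mutual A w a b.
Proof.
move=> ks e1 e2 e3.
by rewrite truth_and (truth_reach_known ks e1 e2 e3) (truth_reach_known ks e1 e3 e2).
Qed.

(** [repr] is a simulation relation: the inner loop performs one sweep, with the counter as the
    length of the processed prefix of [enum V]. *)
Lemma sweeps_run (St : Type) (step : St -> V -> St) (repr : store -> St -> Prop) v1 v2 p s t :
  wf (For v1 (For v2 p)) ->
  (forall s t, repr s t -> s 0 0 0 = N) ->
  (forall s t m, repr s t -> repr (update s v1 0 0 m) t /\ repr (update s v2 0 0 m) t) ->
  (forall (s : store) t (v : V), s v2 0 0 = v -> repr s t -> repr (run p s) (step t v)) ->
  repr s t -> repr (run (For v1 (For v2 p)) s) (iter #|V| (sweep step) t).
Proof.
move=> wfp dim stab body rst.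
have inner s' t' : repr s' t' -> repr (run (For v2 p) s') (sweep step t').
  move=> rst'; have s0 := dim _ _ rst'.
  have -> : sweep step t' = foldl step t' (take (s' 0 0 0) (enum V)).
    by rewrite s0 take_oversize ?size_enum_ord.
  apply: (@run_For (fun m s => repr s (foldl step t' (take m (enum V))))).
  - by case/and3P: wfp.
  - by move=> m s1 c /stab h; case: (h c).
  - by rewrite take0.
  move=> m s1 mN vm _ h; rewrite s0 in mN; rewrite (take_nth ord0) ?size_enum_ord // -cats1 foldl_cat /=.
  by apply: body => //; rewrite vm nth_enum_ord.
rewrite card_ord -[in iter _](dim _ _ rst).
apply: (@run_For (fun m s => repr s (iter m (sweep step) t))) => //.
  by move=> m s1 c /stab h; case: (h c).
by move=> m s1 _ _ _ h; rewrite iterS; apply: inner.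
Qed.

Definition tree_repr (s : store) (t : {ffun V -> V} * {set V}) : Prop :=
  [/\ known s, forall u : V, s 6 u 0 = t.1 u & forall u : V, (s 7 u 0 != 0) = (u \in t.2)].

(** The flag is cleared once some [u] satisfies [P]; the hypothesis on [c] makes the test
    independent of the flag. *)
Lemma flag_run c (P : pred V) s : s 0 0 0 = N -> s 20 0 0 = 1 ->
  (forall s' (u : V), eval s' (var 12) = u ->
     (forall x i j, x \notin [:: 12; 20] -> s' x i j = s x i j) -> truth s' c = P u) ->
  (run (For 12 (When c (set_var 20 (Const 0)))) s 20 0 0 != 0) = [forall u, ~~ P u].
Proof.
move=> s0 sf cP.
have -> : [forall u, ~~ P u] = [forall u : V, (u < s 0 0 0) ==> ~~ P u].
  by apply: eq_forallb => u; rewrite s0 ltn_ord.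
apply: (@run_For (fun m s' => (s' 20 0 0 != 0) = [forall u : V, (u < m) ==> ~~ P u])) => //.
  by rewrite sf; apply/esym/forallP.
move=> m s' mN vm fr h; rewrite s0 in mN; pose u := Ordinal mN.
rewrite run_When (cP s' u) //.
have -> : [forall u0 : V, (u0 < m.+1) ==> ~~ P u0] = ~~ P u && (s' 20 0 0 != 0).
  rewrite h; apply/forallP/andP => [all|[hu /forallP all] u0].
    split; first by have := all u; rewrite /= ltnSn.
    by apply/forallP=> u0; apply/implyP=> lt; have := all u0; rewrite ltnS (ltnW lt).
  apply/implyP; rewrite ltnS leq_eqVlt => /orP[/eqP e|lt]; last by have := all u0; rewrite lt.
  by have -> : u0 = u by apply: val_inj.
by case: (P u).
Qed.

Lemma check_run s (v p : V) : known s -> s 11 0 0 = v -> s 21 0 0 = p -> s 20 0 0 = 1 ->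
  (run check_prog s 20 0 0 != 0) =
  [forall u, (u != v) && mutual A p u v ==> ~~ mutual A v u p].
Proof.
move=> ks sv sp sf; have s0 : s 0 0 0 = N by case: ks => -[].
rewrite (@flag_run _ (fun u => (u != v) && (mutual A p u v && mutual A v u p))) //.
  by apply: eq_forallb => u; rewrite andbA negb_and implybE.
move=> s' u e12 fr.
have ks' : known s' by apply: known_eq ks => x i j; rewrite !inE => /or3P[]/eqP->; apply: fr.
have e11 : eval s' (var 11) = v by rewrite /= fr.
have e21 : eval s' (var 21) = p by rewrite /= fr.
rewrite truth_and truth_neq truth_and.
rewrite (truth_mutual ks' e21 e12 e11) (truth_mutual ks' e11 e12 e21).
by rewrite e12 e11 val_eqE.
Qed.

Lemma settle_run s (v p : V) (f : V -> V) : known s -> s 11 0 0 = v -> s 21 0 0 = p ->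
  f v = p -> (forall u : V, s 6 u 0 = f u) ->
  forall u : V, run settle_prog s 6 u 0 = settle A f v u.
Proof.
move=> ks sv sp fv sf; have s0 : s 0 0 0 = N by case: ks => -[].
have : forall u : V, run settle_prog s 6 u 0 = if u < s 0 0 0 then settle A f v u else f u.
  apply: (@run_For (fun m s' => forall u : V, s' 6 u 0 =
    if u < m then settle A f v u else f u)) => //.
  move=> m s' mN vm fr h u; rewrite s0 in mN; pose u0 := Ordinal mN.
  have ks' : known s' by apply: known_eq ks => x i j; rewrite !inE => /or3P[]/eqP->; apply: fr.
  have e12 : eval s' (var 12) = u0 by [].
  have e11 : eval s' (var 11) = v by rewrite /= fr.
  have e21 : eval s' (var 21) = p by rewrite /= fr.
  rewrite run_When truth_and truth_neq (truth_mutual ks' e21 e12 e11) e12 e11 val_eqE.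
  have [eu|nu] := eqVneq u u0.
    rewrite eu /= ltnSn ffunE fv; case: ifP => _.
      by rewrite /= in e11; rewrite vm /update !eqxx /= e11.
    by have := h u0; rewrite /= ltnn.
  have num : (u == m :> nat) = false by rewrite -[m]/(val u0) val_eqE (negbTE nu).
  have -> : (u < m.+1) = (u < m) by rewrite ltnS leq_eqVlt num.
  case: ifP => _; last exact: h.
  by rewrite -h /run e12 /update /= num.
by move=> h u; rewrite h s0 ltn_ord.
Qed.

Lemma tree_step_run s t (v : V) : s 11 0 0 = v -> tree_repr s t ->
  tree_repr (run tree_step_prog s) (tree_step A t v).
Proof.
case: t => f D sv [ks sf sD]; rewrite /= in sf sD.
have -> : run tree_step_prog s = if v \notin D
    then run (Then (set_var 20 (Const 1)) (Then (set_var 21 (arr 6 (var 11))) (Then check_prog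
      (When (var 20) (Then (Asg 7 (var 11) (Const 0) (Const 1)) settle_prog))))) s else s.
  by rewrite run_When truth_not /truth [eval _ _]/= sv sD.
rewrite /tree_step [(f, D).2]/= [(f, D).1]/=.
case: ifP => // vD; rewrite 2!run_Then; set s2 := run (set_var 21 _) _.
have k2 : known s2 by apply: known_eq ks => x i j; rewrite !inE => /or3P[]/eqP->.
have p2 : s2 21 0 0 = f v by rewrite -sf -sv.
have v2 : s2 11 0 0 = v by [].
have b2 : s2 20 0 0 = 1 by [].
have ck : (run check_prog s2 20 0 0 != 0) = ready A f v := check_run k2 v2 p2 b2.
rewrite run_Then; set s3 := run check_prog s2 in ck *.
have fr3 x i j : x \notin writes check_prog -> s3 x i j = s2 x i j by apply: run_frame.
rewrite run_When -[truth s3 _]/(s3 20 0 0 != 0) ck; case: ifP => rdy; last first.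
  split; first by apply: known_eq k2 => x i j; rewrite !inE => /or3P[]/eqP->; apply: fr3.
    by move=> u; rewrite fr3 //; apply: sf.
  by move=> u; rewrite fr3 //; apply: sD.
have v3 : s3 11 0 0 = v by rewrite fr3.
rewrite run_Then; set s4 := run (Asg 7 _ _ _) s3.
have k4 : known s4 by apply: known_eq k2 => x i j; rewrite !inE => /or3P[]/eqP->; apply: fr3.
have fr5 x i j : x \notin writes settle_prog -> run settle_prog s4 x i j = s4 x i j by apply: run_frame.
split.
- by apply: known_eq k4 => x i j; rewrite !inE => /or3P[]/eqP->; apply: fr5.
- have p4 : s4 21 0 0 = f v by rewrite -p2 -[LHS]/(s3 21 0 0) fr3.
  have f4 (u : V) : s4 6 u 0 = f u by rewrite -sf -[LHS]/(s3 6 u 0) fr3.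
  exact: settle_run k4 v3 p4 erefl f4.
move=> u; rewrite fr5 // -[s4 7 u 0]/(if (u == s3 11 0 0 :> nat) && true then 1 else s3 7 u 0).
rewrite v3 andbT val_eqE !inE.
by case: (eqVneq u v) => //= _; rewrite fr3 // -sD.
Qed.

Definition label_repr (f : V -> V) s (t : {ffun V -> nat} * nat) : Prop :=
  [/\ known s, forall u : V, s 6 u 0 = f u, forall u : V, s 8 u 0 = t.1 u & s 22 0 0 = t.2].

Lemma truth_before f s ex ey (x y : V) : known s -> (forall u : V, s 6 u 0 = f u) ->
  eval s ex = x -> eval s ey = y -> truth s (beforeE ex ey) = before A ord0 f x y.
Proof.
move=> ks sf e1 e2.
have f1 : eval s (arr 6 ex) = f x by rewrite /= e1 sf.
have f2 : eval s (arr 6 ey) = f y by rewrite /= e2 sf.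
rewrite !truthE (truth_reach_known ks f1 e1 e2) (truth_reach_known ks e2 e1 f2).
by rewrite (truth_reach_known ks e1 f1 e2) /truth f1 f2 e1 e2 /before -!val_eqE.
Qed.

Lemma label_check_run f s (lam : V -> nat) (v : V) : known s ->
  (forall u : V, s 6 u 0 = f u) -> (forall u : V, s 8 u 0 = lam u) ->
  s 11 0 0 = v -> s 20 0 0 = 1 ->
  (run label_check_prog s 20 0 0 != 0) =
  [forall u, (u != ord0) && (lam u == 0) ==> ~~ before A ord0 f u v].
Proof.
move=> ks sf sl sv sb; have s0 : s 0 0 0 = N by case: ks => -[].
rewrite (@flag_run _ (fun u => (u != ord0) && (lam u == 0) && before A ord0 f u v)) //.
  by apply: eq_forallb => u; rewrite negb_and implybE.
move=> s' u e12 fr.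
have ks' : known s' by apply: known_eq ks => x i j; rewrite !inE => /or3P[]/eqP->; apply: fr.
have e11 : eval s' (var 11) = v by rewrite /= fr.
have f' (z : V) : s' 6 z 0 = f z by rewrite fr.
have t1 : truth s' (var 12) = (u != ord0) by rewrite /truth e12 -val_eqE.
have t2 : truth s' (arr 8 (var 12)) = (lam u != 0).
  by rewrite /truth -[eval _ _]/(s' 8 (eval s' (var 12)) 0) e12 fr // sl.
by rewrite 2!truth_and truth_not t1 t2 (truth_before ks' f' e12 e11) negbK.
Qed.

Lemma label_step_run f s t (v : V) : s 11 0 0 = v -> label_repr f s t ->
  label_repr f (run label_step_prog s) (label_step A ord0 f t v).
Proof.
case: t => lam c sv [ks sf sl sc]; rewrite /= in sl sc.
have -> : run label_step_prog s = if (v != ord0) && (lam v == 0)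
    then run (Then (set_var 20 (Const 1)) (Then label_check_prog
      (When (var 20) (Then (set_var 22 (Add (var 22) (Const 1)))
        (Asg 8 (var 11) (Const 0) (var 22)))))) s else s.
  by rewrite run_When truth_and truth_not /truth [eval _ (var _)]/= [eval _ _]/= sv sl negbK.
rewrite /label_step /label_ready [(lam, c).2]/= [(lam, c).1]/= andbA.
case: ifP => // vl; rewrite run_Then; set s2 := run (set_var 20 _) _.
have k2 : known s2 by apply: known_eq ks => x i j; rewrite !inE => /or3P[]/eqP->.
have ck : (run label_check_prog s2 20 0 0 != 0) =
    [forall u, (u != ord0) && (lam u == 0) ==> ~~ before A ord0 f u v].
  by apply: label_check_run k2 _ _ _ _.
rewrite run_Then; set s3 := run label_check_prog s2 in ck *.
have fr3 x i j : x \notin writes label_check_prog -> s3 x i j = s2 x i j by apply: run_frame.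
have k3 : known s3 by apply: known_eq k2 => x i j; rewrite !inE => /or3P[]/eqP->; apply: fr3.
rewrite run_When -[truth s3 _]/(s3 20 0 0 != 0) ck; case: ifP => rdy; last first.
  split=> // [u|u|]; rewrite fr3 //; [exact: sf|exact: sl].
have v3 : s3 11 0 0 = v by rewrite fr3.
have c3 : s3 22 0 0 = c by rewrite fr3.
rewrite run_Then; set s4 := run (set_var 22 _) s3; set s5 := run _ s4.
split.
- by apply: known_eq k3 => x i j; rewrite !inE => /or3P[]/eqP->.
- by move=> u; rewrite -[LHS]/(s3 6 u 0) fr3 //; apply: sf.
- move=> u; rewrite ffunE.
  rewrite -[s5 8 u 0]/(if (u == s3 11 0 0 :> nat) && true then s3 22 0 0 + 1 else s3 8 u 0).
  by rewrite v3 c3 andbT val_eqE addn1; case: (eqVneq u v) => // _; rewrite fr3 //; apply: sl.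
- by rewrite -[LHS]/(s3 22 0 0 + 1) c3 addn1.
Qed.

Lemma output_run s : s 0 0 0 = N ->
  let s' := run output_prog s in s' 2 0 0 = n /\
  forall m, m < N -> [/\ s' 3 m 0 = m.+1, s' 3 m 1 = s 6 m.+1 0 & s' 3 m 2 = s 8 m.+1 0].
Proof.
move=> s0 s'; rewrite /s' /output_prog run_Then; set s1 := run (For 10 _) s.
have z1 : s1 0 0 0 = N by rewrite /s1 run_frame.
split; first by rewrite -[LHS]/(s1 0 0 0 - 1) z1 subn1.
have : forall m, m < s 0 0 0 ->
    [/\ s1 3 m 0 = m.+1, s1 3 m 1 = s 6 m.+1 0 & s1 3 m 2 = s 8 m.+1 0].
  apply: (@run_For (fun k s' => forall m, m < k ->
    [/\ s' 3 m 0 = m.+1, s' 3 m 1 = s 6 m.+1 0 & s' 3 m 2 = s 8 m.+1 0])) => //.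
  move=> k s2 kN vk fr h m; rewrite ltnS leq_eqVlt => /orP[/eqP->|lt].
    rewrite /run /= /update /= vk !eqxx /= addn1; split=> //.
    - by rewrite fr.
    - by rewrite fr.
  have km : (m == k) = false by rewrite ltn_eqF.
  by rewrite /run /= /update /= vk !km /=; apply: h.
by rewrite s0.
Qed.

End Phases.

Lemma tree_solution_prog_correct n (A : rel 'I_n.+1) :
  strongly_connected A -> walk_helly A ->
  exists G : temporal_graph 'I_n.+1,
    output_is (run tree_solution_prog (input_store A)) G /\ tree_solution A G.
Proof.
move=> sc hA; rewrite /tree_solution_prog 6!run_Then.
set s0 := input_store A.
have arcs0 : arcs A s0 by move=> a b; rewrite /s0 /input_store /= !valK.
set s1 := run base_prog s0; have d1 : dims n s1 by apply: base_run.
have arcs1 : arcs A s1 by move=> a b; rewrite /s1 run_frame.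
have [w a b|so2 re2] := @refl_run n A s1 d1.
  by rewrite /reached /s1 run_frame.
set s2 := run refl_prog s1 in so2 re2 *.
have d2 : dims n s2 by apply: dims_eq d1 => i j; rewrite /s2 run_frame.
have arcs2 : arcs A s2 by move=> a b; rewrite /s2 run_frame.
have r3 := reach_run d2 arcs2 so2 re2.
set s3 := run (For 11 extend_prog) s2 in r3 *.
have zero3 x i j : x \in [:: 6; 7; 8; 22] -> s3 x i j = 0.
  rewrite !inE => /or4P[]/eqP->; by rewrite /s3 run_frame // /s2 run_frame // /s1 run_frame.
set s4 := run (Asg 7 _ _ _) s3.
have k4 : known A s4.
  split; last exact: r3.
  by apply: dims_eq d2 => i j; [rewrite -[LHS]/(s3 0 i j)|rewrite -[LHS]/(s3 5 i j)];
    rewrite /s3 run_frame.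
(* The untouched zeros of array 6 already encode the parent function that is constantly the root 0;
   only the root had to be marked as settled. *)
have t4 : tree_repr A s4 ([ffun=> ord0], [set ord0]).
  split=> // u; first by rewrite ffunE -[LHS]/(s3 6 u 0) zero3.
  rewrite inE -[s4 7 u 0]/(if (u == 0 :> nat) && true then 1 else s3 7 u 0) zero3 // andbT.
  by rewrite -[u == ord0]/(u == 0 :> nat); case: (u == 0 :> nat).
have t5 : tree_repr A (run (For 10 (For 11 tree_step_prog)) s4) (tree_sweeps A ord0).
  apply: sweeps_run t4 => //; first by move=> s t [[[]]].
  by move=> s t v; apply: tree_step_run.
set s5 := run _ s4 in t5 *.
have nf := @tree_sweeps_normal _ A ord0 hA; set f := (tree_sweeps A ord0).1 in nf.
have l5 : label_repr A f s5 ([ffun=> 0], 0).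
  case: t5 => k5 f5 _; split=> // [u|]; rewrite ?ffunE.
    by rewrite /s5 run_frame // -[LHS]/(s3 8 u 0) zero3.
  by rewrite /s5 run_frame // -[LHS]/(s3 22 0 0) zero3.
have l6 : label_repr A f (run (For 10 (For 11 label_step_prog)) s5) (label_sweeps A ord0 f).
  apply: sweeps_run l5 => //; first by move=> s t [[[]]].
  by move=> s t v; apply: label_step_run.
set s6 := run _ s5 in l6 *.
have [pos lt] := label_sweepsP nf; set lam := (label_sweeps A ord0 f).1 in pos lt.
have [G pG] := parent_graph (normal_fix nf) (depth_lt nf) pos.
exists G; split; last exact: normal_tree_solution sc nf lt pG.
case: l6 => -[[z6 _] _] f6 lam6 _; have [cnt rows] := output_run z6.
(* [lift ord0 k] is the vertex [k + 1], so the rows run through all vertices but the root. *)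
pose at_ k := let x := lift ord0 k in (x, f x, lam x).
exists [seq at_ k | k <- enum 'I_n]; split.
- apply: perm_trans pG _.
  rewrite [X in perm_eq _ X](_ : _ =
    [seq ([set x; f x], lam x) | x <- [seq lift ord0 k | k <- enum 'I_n]]); last by rewrite -!map_comp.
  apply/perm_map/uniq_perm; rewrite ?enum_uniq ?(map_inj_uniq lift_inj) ?enum_uniq //.
  move=> x; rewrite mem_enum inE; case: (unliftP ord0 x) => [k|] ->.
    by rewrite eq_sym neq_lift map_f ?mem_enum.
  by rewrite eqxx; apply/esym/negbTE/mapP=> -[k _ /eqP]; rewrite (negbTE (neq_lift _ _)).
- by rewrite cnt size_map size_enum_ord.
move=> k u v t; rewrite onth_map; case E: (onth _ k) => [i|] // [<- <- <-].
have kn : k < n by have := onthTE (enum 'I_n) k; rewrite E size_enum_ord => <-.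
have ki : k.+1 = lift ord0 i :> nat by rewrite -(@onth_nth _ i _ _ _ E) lift0 nth_enum_ord.
by have [-> -> ->] := rows k (ltnW kn); rewrite ki f6 lam6.
Qed.

Theorem theorem4p10 :
  (forall (V : finType) (A : rel V), strongly_connected A ->
     (walk_helly A <-> exists T : rel V, tree_representation A T) /\
     ((exists T : rel V, tree_representation A T) <->
      exists G : temporal_graph V, tree_solution A G)) /\
  tree_solution_in_poly_time.
Proof.
split=> [V A sc|].
  have [V0 _] := sc; have [r _] := card_gt0P V0.
  have to_helly : (exists T : rel V, tree_representation A T) -> walk_helly A.
    by case=> T; apply: tree_representation_helly.
  have to_rep : walk_helly A -> exists T : rel V, tree_representation A T.
    move=> hA; exists (parent_rel (tree_sweeps A r).1).
    exact: normal_tree_representation (tree_sweeps_normal r hA).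
  split; first by split.
  split=> [/to_helly hA|[G ts]]; last exact/to_rep/(tree_solution_helly sc ts).
  have nf := tree_sweeps_normal r hA; have [pos lt] := label_sweepsP nf.
  have [G pG] := parent_graph (normal_fix nf) (depth_lt nf) pos.
  by exists G; apply: normal_tree_solution sc nf lt pG.
have [c [d h]] := compile_poly wf_tree_solution_prog.
(* Strong connectivity includes a nonempty vertex set, which excludes size 0. *)
exists (compile tree_solution_prog), c, d => -[|n] A sc [G ts].
  by case: sc; rewrite card_ord.
have [t [le e]] := h (input_store A).
have [G' [out ts']] := tree_solution_prog_correct sc (tree_solution_helly sc ts).
by exists t, (run tree_solution_prog (input_store A)), G'; split.
Qed.
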